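(* Let $d\ge2$ and $\sigma>0$. Let $\alpha$ be a probability measure on $\mathbb{R}^d$ with density $f_\alpha$ and let $\Omega_\alpha$ be the interior of the support of $\alpha$. Assume that $\Omega_\alpha$ is bounded and connected with Lipschitz boundary $\partial\Omega_\alpha$, and that there exists $\lambda\ge1$ such that $\lambda^{-1}\le f_\alpha(z)\le\lambda$ for all $z\in\Omega_\alpha$. If $y_i$, $i\in\mathbb{N}$, are i.i.d. random variables with distribution $\alpha$ and $\alpha_n=\frac1n\sum_{i=1}^n\delta_{y_i}$, then for any $p>1$ there are constants $C=C(\sigma,\Omega_\alpha,\lambda,p)>0$ and $c_1=c_1(\Omega_\alpha,\lambda)>0$ such that for all $n\in\mathbb{N}$ $$\mathbb{P}\left(\sup_{x\in\mathbb{R}^d}\left\|\Sigma_{\alpha_n}(x,\sigma)-\Sigma_\alpha(x,\sigma)\right\|\le C\,r_d(n)\right)\ge1-c_1n^{-p},$$ where $\Sigma$ is the covariance tensor field associated with the truncation kernel, $r_2(n)=\frac{\ln(n)^{3/4}}{n^{1/2}}$ and $r_d(n)=\frac{\ln(n)^{1/d}}{n^{1/d}}$ for $d\ge3$.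
   Context: The truncation kernel is $T(x,y,\sigma)=\frac{1}{\sigma^d\nu_d}\chi\!\left(\frac{\|y-x\|^2}{\sigma^2}\right)$, where $\chi$ is the characteristic function of $[0,1]$ and $\nu_d$ is the volume of the unit ball in $\mathbb{R}^d$. For a Borel probability measure $\alpha$, $\Sigma_\alpha(x,\sigma)=\int(y-x)\otimes(y-x)\,T(x,y,\sigma)\,\alpha(dy)\in\mathbb{R}^d\otimes\mathbb{R}^d$; identifying $x\otimes y$ with $xy^T$, $\|\cdot\|$ is the Frobenius norm. *)

(* Defs.v *)
From HB Require Import structures.
From mathcomp Require Import all_boot all_order all_algebra.
From mathcomp Require Import all_classical all_reals all_analysis.
From mathcomp Require Import measurable_realfun.

Set Implicit Arguments.
Unset Strict Implicit.
Unset Printing Implicit Defensive.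

Import Order.TTheory GRing.Theory Num.Theory.
Import numFieldNormedType.Exports.

Local Open Scope classical_set_scope.
Local Open Scope ring_scope.

(* R^d is 'rV[R]_d with its Borel sigma-algebra. *)
Section borel_rV.
Context (R : realType) (d : nat).

Definition borel_rV : set (set 'rV[R]_d) := <<s [set U | open U] >>.

Lemma borel_rV0 : borel_rV set0.
Proof. exact: sigma_algebra0. Qed.

Lemma borel_rVC A : borel_rV A -> borel_rV (~` A).
Proof. exact: (@sigma_algebraC 'rV[R]_d). Qed.

Lemma borel_rV_bigcup (F : (set 'rV[R]_d)^nat) :
  (forall i, borel_rV (F i)) -> borel_rV (\bigcup_i F i).
Proof. exact: sigma_algebra_bigcup. Qed.

HB.instance Definition _ := @isMeasurable.Build
  (sigma_display [set U : set 'rV[R]_d | open U]) 'rV[R]_d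
  borel_rV borel_rV0 borel_rVC borel_rV_bigcup.

Lemma open_measurable_rV (U : set 'rV[R]_d) : open U -> measurable U.
Proof. by move=> oU; apply: sub_sigma_algebra. Qed.

Lemma measurable_coord (i : 'I_d) :
  measurable_fun setT (fun v : 'rV[R]_d => v ord0 i).
Proof.
apply: (measurability _ (RGenOpens.measurableE R)) => _ [_ [a [b ->]] <-].
rewrite setTI; apply: open_measurable_rV; apply: open_comp; last exact: interval_open.
by move=> v _; exact: coord_continuous.
Qed.

Lemma open_rV_bigcup (U : set 'rV[R]_d) : open U ->
  U = \bigcup_(q in [set q : 'rV[rat]_d * nat |
        ball (map_mx ratr q.1 : 'rV[R]_d) q.2.+1%:R^-1 `<=` U])
      ball (map_mx ratr q.1 : 'rV[R]_d) q.2.+1%:R^-1.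
Proof.
move=> oU; apply/seteqP; split=> [x Ux|x [q /= qU]]; last exact: qU.
have /nbhs_ballP[e /= e0 eU] : nbhs x U by exact: open_nbhs_nbhs.
have [k ke] : exists k : nat, k.+1%:R^-1 < e / 2.
  have [k _ kP] := near_infty_natSinv_lt (PosNum (divr_gt0 e0 (ltr0n R 2))).
  by exists k; apply: (kP k) => /=.
have k0 : 0 < k.+1%:R^-1 :> R by rewrite invr_gt0 ltr0n.
have /choice[q qP] : forall j, exists q : rat, `|x ord0 j - ratr q| < k.+1%:R^-1.
  move=> j.
  have [|q] := @rat_in_itvoo R (x ord0 j) (x ord0 j + k.+1%:R^-1).
    by rewrite ltrDl.
  rewrite in_itv/= => /andP[xq qx]; exists q.
  by rewrite distrC ger0_norm ?subr_ge0 1?ltW// ltrBlDl.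
have qx : ball (map_mx ratr (\row_j q j) : 'rV[R]_d) k.+1%:R^-1 x.
  split=> // i j; rewrite ord1 !mxE /ball/= distrC; exact: qP.
exists (\row_j q j, k) => //= y qy; apply: eU.
apply: (@le_ball _ _ x (k.+1%:R^-1 + k.+1%:R^-1)).
  by rewrite [leRHS]splitr lerD// ltW.
exact: (ball_triangle (ball_sym qx) qy).
Qed.

End borel_rV.

Lemma measurable_rV (R : realType) (d : nat) (d' : measure_display)
    (T : measurableType d') (f : T -> 'rV[R]_d) :
  (forall j, measurable_fun setT (fun t => f t ord0 j)) ->
  measurable_fun setT f.
Proof.
move=> mf.
apply: (measurability [set U : set 'rV[R]_d | open U]) => // _ [U oU <-].
rewrite setTI (open_rV_bigcup oU) preimage_bigcup bigcup_mkcond.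
apply: countable_bigcupT_measurable => // q; case: ifP => // _.
rewrite (_ : _ @^-1` _ = \bigcap_(j in [set: 'I_d])
    ((fun t => f t ord0 j) @^-1` ball (ratr (q.1 ord0 j) : R) q.2.+1%:R^-1)).
  apply: fin_bigcap_measurable => // j _.
  rewrite -[X in measurable X]setTI; apply: mf => //.
  by apply: open_measurable; exact: ball_open.
apply/seteqP; split=> [t [_ +] j _|t tP].
  by move=> /(_ ord0 j); rewrite mxE.
split=> [|i j]; first by rewrite invr_gt0 ltr0n.
by rewrite ord1 mxE; exact: tP.
Qed.

(* Prepending a coordinate, R x R^d -> R^(d+1), and its inverse. *)
Section cons_rV.
Context (R : realType) (d : nat).

Definition cons_rV (p : measurableTypeR R * 'rV[R]_d) : 'rV[R]_d.+1 :=
  row_mx (const_mx p.1 : 'rV_1) p.2.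

Definition uncons_rV (v : 'rV[R]_d.+1) : measurableTypeR R * 'rV[R]_d :=
  (v ord0 ord0, \row_j v ord0 (lift ord0 j)).

Lemma cons_rV0 p : cons_rV p ord0 ord0 = p.1.
Proof.
rewrite /cons_rV; have -> : ord0 = lshift d ord0 :> 'I_(1 + d) by exact: val_inj.
by rewrite (row_mxEl (const_mx p.1 : 'rV_1)) mxE.
Qed.

Lemma cons_rVS p j : cons_rV p ord0 (lift ord0 j) = p.2 ord0 j.
Proof.
rewrite /cons_rV; have -> : lift ord0 j = rshift 1 j :> 'I_(1 + d) by exact: val_inj.
by rewrite (row_mxEr (const_mx p.1 : 'rV_1)).
Qed.

Lemma cons_rVK : cancel cons_rV uncons_rV.
Proof.
move=> [x v]; rewrite /uncons_rV cons_rV0; congr pair.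
by apply/rowP => j; rewrite mxE cons_rVS.
Qed.

Lemma measurable_cons_rV : measurable_fun setT cons_rV.
Proof.
apply: measurable_rV => j; have [j'|] := unliftP ord0 j => ->.
  rewrite (_ : (fun _ => _) = (fun v : 'rV[R]_d => v ord0 j') \o snd).
    by apply: measurableT_comp => //; exact: measurable_coord.
  by apply/funext => p /=; rewrite cons_rVS.
by rewrite (_ : (fun _ => _) = fst)//; apply/funext => p; rewrite cons_rV0.
Qed.

Lemma measurable_uncons_rV : measurable_fun setT uncons_rV.
Proof.
apply/measurable_fun_pairP; split; first exact: measurable_coord.
apply: measurable_rV => j /=.
rewrite (_ : (fun _ => _) = (fun v : 'rV[R]_d.+1 => v ord0 (lift ord0 j))).
  exact: measurable_coord.
by apply/funext => v /=; rewrite mxE.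
Qed.

End cons_rV.

Section lebesgue_rV.
Context (R : realType).

Section step.
Context (d : nat) (mu : {sigma_finite_measure set 'rV[R]_d -> \bar R}).

Definition lebesgue_rVS : set 'rV[R]_d.+1 -> \bar R :=
  pushforward (@lebesgue_measure R \x mu)%E (@cons_rV R d).

Let mcons := @measurable_cons_rV R d.

Let lebesgue_rVS0 : lebesgue_rVS set0 = 0%E.
Proof. by rewrite /lebesgue_rVS /pushforward preimage_set0 measure0. Qed.

Let lebesgue_rVS_ge0 A : (0 <= lebesgue_rVS A)%E.
Proof. exact: measure_ge0. Qed.

Let lebesgue_rVS_sigma_additive : semi_sigma_additive lebesgue_rVS.
Proof. exact: measure_semi_sigma_additive. Qed.

HB.instance Definition _ := isMeasure.Build _ _ _ lebesgue_rVS
  lebesgue_rVS0 lebesgue_rVS_ge0 lebesgue_rVS_sigma_additive.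

Let lebesgue_rVS_sigma_finite : sigma_finite setT lebesgue_rVS.
Proof.
have /sigma_finiteP[F [FT ndF Foo]] := sigma_finiteT (@lebesgue_measure R).
have /sigma_finiteP[G [GT ndG Goo]] := sigma_finiteT mu.
have mFG k : measurable (F k `*` G k).
  by apply: measurableX; [exact: (Foo k).1|exact: (Goo k).1].
exists (fun k => @uncons_rV R d @^-1` (F k `*` G k)) => [|k].
  apply/seteqP; split=> // v _.
  have [n _ Fn] : (\bigcup_i F i) (uncons_rV v).1 by rewrite -FT.
  have [m _ Gm] : (\bigcup_i G i) (uncons_rV v).2 by rewrite -GT.
  exists (maxn n m) => //; split.
    by have /subsetPset := ndF _ _ (leq_maxl n m); exact.
  by have /subsetPset := ndG _ _ (leq_maxr n m); exact.
split.
  by rewrite -[X in measurable X]setTI; exact: measurable_uncons_rV.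
rewrite /lebesgue_rVS /pushforward -comp_preimage.
rewrite (_ : _ \o _ = id); last by apply/funext => p /=; rewrite cons_rVK.
have [mF Fk] := Foo k; have [mG Gk] := Goo k.
by rewrite preimage_id product_measure1E// lte_mul_pinfty// ge0_fin_numE.
Qed.

HB.instance Definition _ := Measure_isSigmaFinite.Build _ _ _ lebesgue_rVS
  lebesgue_rVS_sigma_finite.

End step.

Fixpoint lebesgue_rV (d : nat) : {sigma_finite_measure set 'rV[R]_d -> \bar R} :=
  match d with
  | 0%N => \d_(0 : 'rV[R]_0)
  | d'.+1 => lebesgue_rVS (lebesgue_rV d')
  end.

Lemma lebesgue_rV_box (d : nat) (a b : 'rV[R]_d) :
  (forall j, a ord0 j <= b ord0 j) ->
  lebesgue_rV d [set v | forall j, a ord0 j <= v ord0 j <= b ord0 j] =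
  (\prod_j (b ord0 j - a ord0 j))%:E.
Proof.
elim: d a b => [|d IHd] a b ab.
  rewrite big_ord0 /= diracE mem_set//; by move=> [].
have mbox n (a' b' : 'rV[R]_n) :
    measurable [set v : 'rV[R]_n | forall j, a' ord0 j <= v ord0 j <= b' ord0 j].
  rewrite (_ : mkset _ = \bigcap_(j in [set: 'I_n])
      ((fun v : 'rV[R]_n => v ord0 j) @^-1` `[a' ord0 j, b' ord0 j])).
    apply: fin_bigcap_measurable => // j _.
    by rewrite -[X in measurable X]setTI; apply: measurable_coord.
  apply/seteqP; split=> v /= vP j; last by have := vP j I; rewrite /= in_itv.
  by move=> _; rewrite /= in_itv; exact: vP.
pose B := [set v : 'rV[R]_d.+1 | forall j, a ord0 j <= v ord0 j <= b ord0 j].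
pose tl (v : 'rV[R]_d.+1) : 'rV[R]_d := \row_j v ord0 (lift ord0 j).
have BE : @cons_rV R d @^-1` B = `[a ord0 ord0, b ord0 ord0] `*`
    [set v : 'rV[R]_d | forall j, tl a ord0 j <= v ord0 j <= tl b ord0 j].
  apply/seteqP; split=> [p /= pP|p /= [p1 p2] j].
    split; first by have := pP ord0; rewrite cons_rV0 in_itv.
    by move=> j; have := pP (lift ord0 j); rewrite cons_rVS !mxE.
  have [j'|] := unliftP ord0 j => ->; last by rewrite cons_rV0; move: p1; rewrite in_itv.
  by have := p2 j'; rewrite cons_rVS !mxE.
transitivity ((@lebesgue_measure R \x lebesgue_rV d)%E (`[a ord0 ord0, b ord0 ord0]
    `*` [set v : 'rV[R]_d | forall j, tl a ord0 j <= v ord0 j <= tl b ord0 j])).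
  by rewrite -BE.
have ab0 : @lebesgue_measure R `[a ord0 ord0, b ord0 ord0] =
    (b ord0 ord0 - a ord0 ord0)%:E.
  rewrite lebesgue_measure_itv/= lte_fin; case: ltP => // ba.
  by apply/eqP; rewrite eqe eq_sym subr_eq0 eq_le ba ab.
rewrite product_measure1E// big_ord_recl EFinM; congr (_ * _)%E; first exact: ab0.
rewrite IHd; last by move=> j; rewrite !mxE.
by congr EFin; apply: eq_bigr => j _; rewrite !mxE.
Qed.

End lebesgue_rV.

(* On row vectors this is the Euclidean norm; the library norm on matrices is
   the sup norm, which induces the same topology and Borel sets. *)
Definition frobenius (R : realType) (m n : nat) (A : 'M[R]_(m, n)) : R :=
  Num.sqrt (\sum_i \sum_j A i j ^+ 2).

Section covariance_field.
Context (R : realType) (d : nat).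
Implicit Types (x y : 'rV[R]_d) (sigma : R).

Definition unit_ball_volume : R :=
  fine (lebesgue_rV R d [set y | frobenius y <= 1]).

Definition truncation_kernel x y sigma : R :=
  (sigma ^+ d * unit_ball_volume)^-1 *
  \1_(`[0, 1]%classic) (frobenius (y - x) ^+ 2 / sigma ^+ 2).

(* x (x) y is the matrix x^T *m y, vectors being rows. *)
Definition covariance_tensor (alpha : {measure set 'rV[R]_d -> \bar R}) x sigma :
    'M[R]_d :=
  \matrix_(i, j) \int[alpha]_y
    (((y - x)^T *m (y - x)) i j * truncation_kernel x y sigma).

Definition empirical_measure (n : nat) (y : nat -> 'rV[R]_d) :
    {measure set 'rV[R]_d -> \bar R} :=
  mscale (n%:R^-1)%:nng (msum (fun i => \d_(y i)) n).

Definition rate (n : nat) : R :=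
  if d == 2%N then ln n%:R `^ (3 / 4) / n%:R `^ (1 / 2)
  else ln n%:R `^ d%:R^-1 / n%:R `^ d%:R^-1.

Definition msupport (alpha : {measure set 'rV[R]_d -> \bar R}) : set 'rV[R]_d :=
  [set x | forall U, open U -> U x -> (0 < alpha U)%E].

Definition is_density (f : 'rV[R]_d -> R)
    (alpha : {measure set 'rV[R]_d -> \bar R}) :=
  [/\ measurable_fun setT f, forall y, 0 <= f y &
      forall A, measurable A ->
        alpha A = (\int[lebesgue_rV R d]_(y in A) (f y)%:E)%E].

(* Near each boundary point, in some orthonormal coordinate system, the set is
   the strict epigraph of a Lipschitz function g of the d - 1 coordinates other
   than the i-th one. *)
Definition lipschitz_boundary (Omega : set 'rV[R]_d) :=
  forall x, (closure Omega `\` Omega°) x ->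
  exists (Q : 'M[R]_d) (i : 'I_d) (g : 'rV[R]_d.-1 -> R),
    [/\ Q *m Q^T = 1%:M, lipschitz g &
        \forall y \near x,
          Omega y <-> g (col' i (y *m Q)) < (y *m Q) ord0 i].

End covariance_field.

Definition mutually_independent (R : realType) (d d' : measure_display)
    (T : measurableType d) (T' : measurableType d') (P : probability T R)
    (X : nat -> {RV P >-> T'}) :=
  forall (J : seq nat) (A : nat -> set T'), uniq J ->
    (forall i, measurable (A i)) ->
    P (\bigcap_(i in [set` J]) (X i @^-1` A i)) =
    (\prod_(i <- J) P (X i @^-1` A i))%E.

Definition iid (R : realType) (d d' : measure_display)
    (T : measurableType d) (T' : measurableType d') (P : probability T R)
    (X : nat -> {RV P >-> T'}) (alpha : probability T' R) :=
  mutually_independent X /\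
  forall i A, measurable A -> distribution P (X i) A = alpha A.

(* Main.v *)
Require Import Defs.
From HB Require Import structures.
From mathcomp Require Import all_boot all_order all_algebra.

(** The truncation kernel has compact support, so the supremum is controlled by
    Vapnik-Chervonenkis theory at the rate [sqrt (ln n / n)], which is at most
    [2 * rate R d n] for [n >= 2].

    Each entry of the covariance tensor is a multiple of the mean of a second
    moment over a ball.  A ghost sample and random swaps reduce the deviation
    from the mean, over all balls with rational centers and radii, to a count of
    sign vectors for a fixed sample of [2 n] points.  These points have at most
    [(2 n + 1) ^ (d + 2)] traces on balls (Sauer-Shelah after lifting to the
    paraboloid), and, for a fixed trace, translating the center of the moment
    to a reference center leaves four signed sums, each handled by an
    exponential moment bound.  Arbitrary balls are pointwise limits of rational
    ones.

    The event is measurable although the supremum is over an uncountable set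
    and the field is discontinuous: splitting according to which sample points
    lie in the ball, its complement is a countable union of sets
    [exists x, h w x <= 0] with [h] coercive and continuous in [x].  Continuity
    of the limit field holds since spheres are Lebesgue negligible. *)

Set Implicit Arguments.
Unset Strict Implicit.
Unset Printing Implicit Defensive.
Import Order.TTheory GRing.Theory Num.Theory.

(** * Shattered sets and halfspaces *)

Definition shatters (I : finType) (F : {set {set I}}) (S : {set I}) :=
  powerset S \subset [set B :&: S | B in F].

Lemma shattersP (I : finType) (F : {set {set I}}) (S : {set I}) :
  reflect (forall A : {set I}, A \subset S -> exists2 B, B \in F & B :&: S = A)
          (shatters F S).
Proof.
apply: (iffP subsetP) => [h A AS|h A].
  have : A \in powerset S by rewrite powersetE.
  by move=> /h /imsetP[B BF ->]; exists B.
by rewrite powersetE => /h[B BF <-]; apply: imset_f.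
Qed.

(* Pajor's strengthening of the Sauer-Shelah lemma, by splitting the family
   along an element on which two of its members differ. *)
Lemma card_le_shattered (I : finType) (F : {set {set I}}) :
  #|F| <= #|[set S | shatters F S]|.
Proof.
have [m] := ubnP #|F|; elim: m F => // m IH F; rewrite ltnS => Fm.
have [|/card_gt1P[B1 [B2 [B1F B2F B12]]]] := leqP #|F| 1.
  rewrite leq_eqVlt ltnS leqn0 cards_eq0 => /orP[/cards1P[B ->]|/eqP->]; last by rewrite cards0.
  rewrite cards1 card_gt0; apply/set0Pn; exists set0; rewrite inE.
  apply/shattersP => A; rewrite subset0 => /eqP ->; exists B; rewrite ?set11//.
  exact: setI0.
have [x xB] : exists x, (x \in B1) != (x \in B2).
  apply/existsP; apply: contraNT B12 => /existsPn h; apply/eqP/setP => x.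
  by have := h x; rewrite negbK => /eqP.
pose F1 := [set B in F | x \in B]; pose F0 := [set B in F | x \notin B].
have F10 : F = F1 :|: F0.
  by apply/setP => B; rewrite !inE -andb_orr orbN andbT.
have dF : [disjoint F1 & F0].
  rewrite disjoint_subset; apply/subsetP => B; rewrite !inE => /andP[_ ->].
  by rewrite andbF.
have cF : #|F| = #|F1| + #|F0|.
  by rewrite {1}F10 cardsU disjoint_setI0// cards0 subn0.
have F1_gt0 : 0 < #|F1|.
  rewrite card_gt0; apply/set0Pn.
  case xB1: (x \in B1); first by exists B1; rewrite inE B1F xB1.
  by exists B2; rewrite inE B2F; move: xB; rewrite xB1; case: (_ \in _).
have F0_gt0 : 0 < #|F0|.
  rewrite card_gt0; apply/set0Pn.
  case xB1: (x \in B1); last by exists B1; rewrite inE B1F xB1.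
  by exists B2; rewrite inE B2F; move: xB; rewrite xB1; case: (_ \in _).
pose sh (G : {set {set I}}) := [set S | shatters G S].
have mono (G : {set {set I}}) : G \subset F -> sh G \subset sh F.
  move=> GF; apply/subsetP => S; rewrite !inE => /shattersP h.
  apply/shattersP => A /h[B BG e]; exists B => //; exact: (subsetP GF).
have F1F : F1 \subset F by rewrite F10 subsetUl.
have F0F : F0 \subset F by rewrite F10 subsetUr.
have x1 S : S \in sh F1 -> x \notin S.
  rewrite inE => /shattersP h; apply/negP => xS.
  have [B] := h set0 (sub0set _); rewrite inE => /andP[_ xB'] /setP/(_ x).
  by rewrite !inE xB' xS.
have x0 S : S \in sh F0 -> x \notin S.
  rewrite inE => /shattersP h; apply/negP => xS.
  have [|B] := h [set x]; first by rewrite sub1set.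
  by rewrite inE => /andP[_ /negbTE xB'] /setP/(_ x); rewrite !inE xB' eqxx.
have IH1 : #|F1| <= #|sh F1|.
  by apply: IH; apply: leq_trans Fm; rewrite cF -[X in X < _]addn0 ltn_add2l.
have IH0 : #|F0| <= #|sh F0|.
  by apply: IH; apply: leq_trans Fm; rewrite cF -[X in X < _]add0n ltn_add2r.
rewrite cF (leq_trans (leq_add IH1 IH0))// -cardsUI.
(* The sum of the two counts is the size of the union plus that of the intersection. A set shattered
   by both halves stays shattered by [F] after adding [x], and the enlarged sets contain [x], so
   they are disjoint from the union. *)
pose addx (S : {set I}) := x |: S.
have addx_inj : {in sh F1 :&: sh F0 &, injective addx}.
  move=> S S' /setIP[/x1 xS _] /setIP[/x1 xS' _] e.
  by rewrite -(setU1K xS) -(setU1K xS'); congr (_ :\ _).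
rewrite -(card_in_imset addx_inj).
have disj : [disjoint sh F1 :|: sh F0 & addx @: (sh F1 :&: sh F0)].
  rewrite disjoint_sym disjoint_subset; apply/subsetP => _ /imsetP[S _ ->].
  rewrite inE; apply/negP; rewrite inE => /orP[/x1|/x0]; by rewrite setU11.
rewrite -[X in X <= _]subn0 -(@cards0 {set I}) -(disjoint_setI0 disj) -cardsU.
apply: subset_leq_card; rewrite !subUset !mono//=.
apply/subsetP => _ /imsetP[S /setIP[S1 S0] ->]; rewrite inE.
have xS := x1 _ S1.
move: S1 S0; rewrite !inE => /shattersP h1 /shattersP h0.
apply/shattersP => A Asub.
have AS : A :\ x \subset S by rewrite subDset.
case xA : (x \in A).
  have [B] := h1 _ AS; rewrite inE => /andP[BF xB'] e; exists B => //.
  by rewrite setIUr e setIC (setIidPl _) ?sub1set// setD1K.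
have [B] := h0 _ AS; rewrite inE => /andP[BF xB'] e; exists B => //.
rewrite setIUr e; have /setIidPl <- : A \subset [set~ x].
  by rewrite -setCS setCK sub1set inE xA.
rewrite -setDE setDDl setUid.
suff -> : B :&: [set x] = set0 by rewrite set0U.
by apply/setP => z; rewrite !inE andbC; case: eqP => // ->; rewrite (negbTE xB').
Qed.

(** A set with at most [k] elements is the range of a partial function on [k] indices. This crude
    count replaces a sum of binomial coefficients. *)
Lemma card_set_le_expn (I : finType) (k : nat) :
  #|[set S : {set I} | #|S| <= k]| <= #|I|.+1 ^ k.
Proof.
pose im (f : {ffun 'I_k -> option I}) := [set x | [exists i, f i == Some x]].
have : [set S : {set I} | #|S| <= k] \subset im @: setT.
  apply/subsetP => S; rewrite inE => Sk; apply/imsetP.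
  exists [ffun i : 'I_k => nth None (map Some (enum S)) i] => //.
  apply/setP => x; rewrite inE; apply/idP/existsP => [xS|[i]].
    have xlt : index x (enum S) < #|S| by rewrite cardE index_mem mem_enum.
    exists (Ordinal (leq_trans xlt Sk)); rewrite ffunE (nth_map x) -?cardE//=.
    by rewrite nth_index// mem_enum.
  rewrite ffunE; have [iS|iS] := ltnP i #|S|; last first.
    by rewrite nth_default// size_map -cardE.
  rewrite (nth_map x) -?cardE// => /eqP[<-].
  by rewrite -mem_enum mem_nth// -cardE.
move=> /subset_leq_card/leq_trans; apply.
rewrite (leq_trans (leq_imset_card _ _))// cardsT card_ffun card_option card_ord.
by [].
Qed.

Local Open Scope ring_scope.

(* The Vapnik-Chervonenkis dimension of the halfspaces of F^k is at most k: a
   linear dependence among k + 1 points prevents a sign pattern. *)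
Lemma card_shattered_halfspace (F : realFieldType) (I : finType) (k : nat)
    (phi : I -> 'rV[F]_k) (G : {set {set I}}) (S : {set I}) :
  (forall B, B \in G -> exists v : 'cV[F]_k,
     forall i, (i \in B) = ((phi i *m v) 0 0 <= 0)) ->
  shatters G S -> (#|S| <= k)%N.
Proof.
move=> hG /shattersP sh; rewrite leqNgt; apply/negP => kS.
pose A := \matrix_(i < #|S|) phi (enum_val i).
have : kermx A != 0.
  rewrite kermx_eq0 -row_leq_rank -ltnNge.
  by rewrite (leq_ltn_trans (rank_leq_col A)).
case/rowV0Pn => c0 /sub_kermxP c0A c0N.
(* The dependence is negated if necessary: a positive coefficient is needed because membership in a
   halfspace is a weak inequality, so only points outside it have a value of strict sign. *)
have [c cA [i0 ci0]] : exists2 c : 'rV[F]_#|S|, c *m A = 0 & exists i, 0 < c 0 i.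
  have [i ci] : exists i, c0 0 i != 0.
    apply/existsP; apply: contra_neqT c0N => /existsPn h; apply/rowP => i.
    by rewrite mxE; apply/eqP; have := h i; rewrite negbK.
  have [ci0|ci0|ci0] := ltgtP (c0 0 i) 0; last by rewrite ci0 eqxx in ci.
    by exists (- c0); [rewrite mulNmx c0A oppr0|exists i; rewrite mxE oppr_gt0].
  by exists c0 => //; exists i.
(* A halfspace cutting out exactly [N] would make every term of the vanishing linear combination
   nonnegative, and the term at [i0] positive. *)
pose N := [set enum_val i | i : 'I_#|S| & c 0 i <= 0].
have NS : N \subset S by apply/subsetP => _ /imsetP[i _ ->]; exact: enum_valP.
have [B BG BN] := sh N NS; have [v vB] := hG B BG.
have inB i : (enum_val i \in B) = (c 0 i <= 0).
  have /setP/(_ (enum_val i)) := BN; rewrite inE enum_valP andbT => ->.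
  apply/imsetP/idP => [[j + /enum_val_inj ->]|ci]; first by rewrite inE.
  by exists i => //; rewrite inE.
have : (c *m A *m v) 0 0 = \sum_i c 0 i * (phi (enum_val i) *m v) 0 0.
  rewrite -mulmxA mxE; apply: eq_bigr => i _; congr (_ * _).
  by rewrite !mxE; apply: eq_bigr => j _; rewrite mxE.
rewrite cA mul0mx mxE => /esym/eqP; rewrite psumr_eq0; last first.
  move=> i _; have := inB i; rewrite vB.
  have [ci|ci] := leP (c 0 i) 0 => h; first by rewrite mulr_le0.
  by rewrite mulr_ge0 ?ltW// ltNge h.
move=> /allP/(_ i0 (mem_index_enum _))/=; rewrite mulf_eq0 gt_eqF//=.
by apply/negP; rewrite gt_eqF// ltNge -vB inB -ltNge.
Qed.

(* Imported only here: [classical_sets] shadows the [finset] lemmas used above. *)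
From mathcomp Require Import all_classical all_reals all_analysis.
From mathcomp Require Import measurable_realfun ring lra.
Import numFieldNormedType.Exports.

(** * Balls and random signs *)

Definition normsq (R : realType) (d : nat) (u : 'rV[R]_d) : R :=
  \sum_j u ord0 j ^+ 2.

Lemma normsq_ge0 (R : realType) (d : nat) (u : 'rV[R]_d) : 0 <= normsq u.
Proof. by apply: sumr_ge0 => j _; exact: sqr_ge0. Qed.

Lemma sqr_coord_le_normsq (R : realType) (d : nat) (u : 'rV[R]_d) j :
  u ord0 j ^+ 2 <= normsq u.
Proof.
rewrite /normsq (bigD1 j)//= lerDl; apply: sumr_ge0 => k _; exact: sqr_ge0.
Qed.

Lemma coord_le_of_normsq (R : realType) (d : nat) (u : 'rV[R]_d) (L : R) j :
  0 <= L -> normsq u <= L ^+ 2 -> `|u ord0 j| <= L.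
Proof.
move=> L0 uL; rewrite -(ler_pXn2r (ltn0Sn 1)) ?nnegrE//.
by rewrite real_normK ?num_real// (le_trans (sqr_coord_le_normsq u j)).
Qed.

(* Balls of R^d are traces of halfspaces of R^(d + 2) under y |-> (y, |y|^2, 1). *)
Lemma card_ball_patterns (R : realType) (d : nat) (I : finType)
    (z : I -> 'rV[R]_d) (G : {set {set I}}) :
  (forall B, B \in G -> exists q rho,
     B = [set j | normsq (z j - q) <= rho]) ->
  (#|G| <= #|I|.+1 ^ d.+2)%N.
Proof.
move=> hG; apply: leq_trans (card_le_shattered G) _.
apply: leq_trans (card_set_le_expn I d.+2).
apply: subset_leq_card; apply/fintype.subsetP => S; rewrite !inE.
rewrite -(addn1 d.+1) -(addn1 d).
pose phi j : 'rV[R]_(d + 1 + 1) :=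
  row_mx (row_mx (z j) (normsq (z j))%:M) 1%:M.
apply: (@card_shattered_halfspace _ _ _ phi) => B /hG[q [rho ->]].
(* These are the coefficients in the expansion of [normsq (z j - q) - rho] as an affine function of
   [z j] and [normsq (z j)]. *)
exists (col_mx (col_mx (- 2 *: q^T) 1%:M) (normsq q - rho)%:M) => j.
rewrite inE !mul_row_col mulmx1 mul1mx -[in RHS]scalemxAr !mxE/= !mulr1n.
rewrite -subr_le0; congr (_ <= 0); rewrite [in RHS]addrA; congr (_ - _).
rewrite /normsq mulr_sumr -!big_split/=; apply: eq_bigr => k _; rewrite !mxE.
by ring.
Qed.

(** The constant 2 in the exponent, instead of the sharp 1/2, lets everything follow from
    [1 + x <= expR x]. Beyond 1/2 one has [x <= 2 * x ^+ 2]; below, that inequality gives [(expR x +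
    expR (- x)) * (1 - x ^+ 2) <= 2]. *)
Lemma cosh_le_expR (R : realType) (x : R) :
  expR x + expR (- x) <= 2 * expR (2 * x ^+ 2).
Proof.
wlog x0 : x / 0 <= x => [h|].
  have [/h//|x0] := leP 0 x.
  by have := h (- x); rewrite opprK sqrrN addrC; apply; rewrite oppr_ge0 ltW.
have [x1|x1] := leP x 2^-1; last first.
  have e1 : expR x <= expR (2 * x ^+ 2) by rewrite ler_expR; nra.
  have e2 : expR (- x) <= expR (2 * x ^+ 2) by rewrite ler_expR; nra.
  by lra.
have ee : expR x * expR (- x) = 1 by rewrite -expRD subrr expR0.
have e1 : expR x * (1 - x) <= 1.
  rewrite -[leRHS]ee ler_wpM2l ?expR_ge0//; exact: expR_ge1Dx.
have e2 : expR (- x) * (1 + x) <= 1.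
  rewrite -[leRHS]ee [leRHS]mulrC ler_wpM2l ?expR_ge0//.
  exact: expR_ge1Dx.
have e3 := expR_ge1Dx (2 * x ^+ 2).
apply: (@le_trans _ _ (2 * (1 + 2 * x ^+ 2))); last by lra.
have h : (expR x + expR (- x)) * (1 - x ^+ 2) <= 2.
  have e1' : expR x * (1 - x) * (1 + x) <= 1 + x.
    by rewrite -[leRHS]mul1r ler_wpM2r// addr_ge0.
  have e2' : expR (- x) * (1 + x) * (1 - x) <= 1 - x.
    by rewrite -[leRHS]mul1r ler_wpM2r//; lra.
  by lra.
have u1 : x ^+ 2 <= 4^-1 by nra.
have u0 := sqr_ge0 x.
have h' : 0 < 1 - x ^+ 2 by nra.
rewrite -(ler_pM2r h'); apply: (le_trans h); nra.
Qed.

Lemma sum_prod_signs (R : comPzRingType) (n : nat) (F : 'I_n -> bool -> R) :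
  \sum_(e : {ffun 'I_n -> bool}) \prod_i F i (e i) =
  \prod_i (F i true + F i false).
Proof.
rewrite -(bigA_distr_bigA (fun i b => F i b)); apply: eq_bigr => i _.
by rewrite big_bool.
Qed.

(** A one-sided Chernoff bound in counting form: the exponential moment, summed over all sign
    vectors, factors over the coordinates. *)
Lemma card_rademacher1 (R : realType) (n : nat) (c : 'I_n -> R) (M tau : R) :
  0 < M -> 0 <= tau -> (forall i, `|c i| <= M) ->
  #|[set e : {ffun 'I_n -> bool} |
     M * (n%:R * tau) < \sum_i (-1) ^+ e i * c i]|%:R <=
  2 ^+ n * expR (- (n%:R * tau ^+ 2 / 8)).
Proof.
move=> M0 tau0 cM; set E := [set _ | _].
(* This minimizes the exponent [2 * n * (th * M) ^ 2 - th * M * n * tau]; the minimum is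
   [- n * tau ^ 2 / 8]. *)
pose th := tau / (4 * M).
have th0 : 0 <= th by rewrite divr_ge0// mulr_ge0// ltW.
have h1 : #|E|%:R * expR (th * (M * (n%:R * tau))) <=
    \sum_(e : {ffun 'I_n -> bool}) expR (th * \sum_i (-1) ^+ e i * c i).
  rewrite (bigID (mem E))/= -[leLHS]addr0 lerD//; last first.
    by apply: sumr_ge0 => e _; exact: expR_ge0.
  rewrite mulr_natl -sumr_const; apply: ler_sum => e; rewrite inE => he.
  by rewrite ler_expR ler_wpM2l// ltW.
have h2 : \sum_(e : {ffun 'I_n -> bool}) expR (th * \sum_i (-1) ^+ e i * c i) <=
    2 ^+ n * expR (n%:R * (2 * (th * M) ^+ 2)).
  under eq_bigr => e _ do rewrite mulr_sumr expR_sum.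
  rewrite (sum_prod_signs (fun i b => expR (th * ((-1) ^+ b * c i)))).
  rewrite -[n in 2 ^+ n]card_ord -prodr_const mulrC -[n in n%:R]card_ord.
  rewrite expRM_natl -prodr_const -big_split/=.
  apply: ler_prod => i _; rewrite addr_ge0 ?expR_ge0//=.
  rewrite expr1 expr0 mulN1r mul1r mulrN addrC.
  apply: (le_trans (cosh_le_expR _)).
  rewrite mulrC ler_wpM2r// ler_expR ler_wpM2l// !exprMn ler_wpM2l//.
    by rewrite mulr_ge0// sqr_ge0.
  by rewrite -(real_normK (num_real (c i))) ler_pXn2r// nnegrE// ltW.
have := le_trans h1 h2; rewrite -ler_pdivlMr ?expR_gt0// => /le_trans; apply.
rewrite -expRN -[leLHS]mulrA -expRD ler_wpM2l ?exprn_ge0// ler_expR.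
rewrite le_eqVlt; apply/orP; left; apply/eqP; rewrite /th; field.
by rewrite gt_eqF.
Qed.

Lemma card_rademacher (R : realType) (n : nat) (c : 'I_n -> R) (M tau : R) :
  0 <= M -> 0 <= tau -> (forall i, `|c i| <= M) ->
  #|[set e : {ffun 'I_n -> bool} |
     M * (n%:R * tau) < `|\sum_i (-1) ^+ e i * c i|]|%:R <=
  2 * 2 ^+ n * expR (- (n%:R * tau ^+ 2 / 8)).
Proof.
(* For [M = 0] the exponential parameter is undefined, but all [c i] vanish and the strict
   inequality never holds. *)
rewrite le_eqVlt => /predU1P[<-|M0] tau0 cM.
  rewrite (_ : [set _ | _] = finset.set0); last first.
    apply/setP => e; rewrite !inE mul0r big1 ?normr0 ?ltxx// => i _.
    by have := cM i; rewrite normr_le0 => /eqP ->; rewrite mulr0.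
  by rewrite cards0 !mulr_ge0// ?exprn_ge0// expR_ge0.
rewrite -mulrA mulrDl mul1r -[X in _ <= X]addrC.
apply: le_trans (lerD (card_rademacher1 M0 tau0 cM)
  (@card_rademacher1 R n (fun i => - c i) M tau M0 tau0 _)); last first.
  by move=> i; rewrite normrN.
rewrite -natrD ler_nat; apply: leq_trans (leq_card_setU _ _).
apply: subset_leq_card; apply/fintype.subsetP => e; rewrite !inE.
rewrite ltr_normr => /orP[->//|h]; apply/orP; right.
by apply: (lt_le_trans h); rewrite -sumrN le_eqVlt; apply/orP; left;
  apply/eqP; apply: eq_bigr => i _; rewrite mulrN.
Qed.

(** The integrand of one tensor entry without the kernel constant. The parameter [rho] is a squared
    radius, so it can be rational whatever [sigma] is. *)
Definition ball_moment (R : realType) (d : nat) (a b : 'I_d) (q : 'rV[R]_d)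
    (rho : R) (y : 'rV[R]_d) : R :=
  (y - q) ord0 a * (y - q) ord0 b * (normsq (y - q) <= rho)%R%:R.

(** A trace on the sample does not determine the moments, which still depend on [q]. Expanding
    around a center that depends on the trace alone leaves four sums independent of [q], to which a
    union bound over traces applies. *)
Lemma card_large_signed_sum (R : realType) (d n : nat) (a b : 'I_d)
    (z : 'I_n * bool -> 'rV[R]_d) (L tau : R) :
  0 <= L -> 0 <= tau ->
  #|[set e : {ffun 'I_n -> bool} | `[< exists q rho, rho <= L ^+ 2 /\
      18 * L ^+ 2 * (n%:R * tau) <
      `|\sum_i (-1) ^+ e i * (ball_moment a b q rho (z (i, false)) -
                              ball_moment a b q rho (z (i, true)))| >]]|%:R <=
  (n.*2.+1 ^ d.+2)%:R * (8 * 2 ^+ n * expR (- (n%:R * tau ^+ 2 / 8))).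
Proof.
move=> L0 tau0.
have s0 : 0 <= n%:R * tau by rewrite mulr_ge0.
pose pat q rho := [set j | normsq (z j - q) <= rho].
pose G := [set B | `[< exists q rho, rho <= L ^+ 2 /\ B = pat q rho >]].
(* One admissible center is fixed for each trace. *)
have /choice[ref refP] : forall B, exists q, B \in G ->
    exists rho, rho <= L ^+ 2 /\ B = pat q rho.
  move=> B; have [|BG] := boolP (B \in G); last by exists 0.
  by rewrite inE => /asboolP[q [rho h]]; exists q => _; exists rho.
pose T (h : 'rV[R]_d -> R) (B : {set 'I_n * bool}) (e : {ffun 'I_n -> bool}) :=
  \sum_i (-1) ^+ e i * (((i, false) \in B)%:R * h (z (i, false) - ref B) -
                        ((i, true) \in B)%:R * h (z (i, true) - ref B)).
pose bad h M B : {set {ffun 'I_n -> bool}} :=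
  [set e | M * (n%:R * tau) < `|T h B e|].
have normB B j : B \in G -> j \in B -> normsq (z j - ref B) <= L ^+ 2.
  move=> /refP[rho [rhoL BE]]; rewrite {1}BE inE => /le_trans; exact.
have card_bad h M B : B \in G -> 0 <= M ->
    (forall u, normsq u <= L ^+ 2 -> `|h u| <= M) ->
    #|bad h (2 * M) B|%:R <= 2 * 2 ^+ n * expR (- (n%:R * tau ^+ 2 / 8)).
  move=> BG M0 hM; apply: card_rademacher => // [|i]; first by rewrite mulr_ge0.
  have hj j : `|(j \in B)%:R * h (z j - ref B)| <= M.
    have [jB|jB] := boolP (j \in B); last by rewrite mul0r normr0.
    by rewrite mul1r hM// normB.
  have -> : 2 * M = M + M by ring.
  by rewrite (le_trans (ler_normB _ _))// lerD.
pose hab (u : 'rV[R]_d) := u ord0 a * u ord0 b.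
pose h1 c (u : 'rV[R]_d) := u ord0 c.
pose badB B : {set {ffun 'I_n -> bool}} := bad hab (2 * L ^+ 2) B :|: bad (h1 a) (2 * L) B :|:
  bad (h1 b) (2 * L) B :|: bad (fun=> 1) (2 * 1) B.
have card_badB B : B \in G ->
    #|badB B|%:R <= 8 * 2 ^+ n * expR (- (n%:R * tau ^+ 2 / 8)).
  move=> BG.
  have b1 := @card_bad hab (L ^+ 2) B BG (sqr_ge0 _) _.
  have ba := @card_bad (h1 a) L B BG L0 (fun u => @coord_le_of_normsq _ _ u L a L0).
  have bb := @card_bad (h1 b) L B BG L0 (fun u => @coord_le_of_normsq _ _ u L b L0).
  have b0 := @card_bad (fun=> 1) 1 B BG ler01 _.
  apply: (@le_trans _ _ (#|bad hab (2 * L ^+ 2) B|%:R + #|bad (h1 a) (2 * L) B|%:R +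
      #|bad (h1 b) (2 * L) B|%:R + #|bad (fun=> 1) (2 * 1) B|%:R)).
    rewrite -!natrD ler_nat.
    by do 3!(apply: leq_trans (leq_card_setU _ _) _; rewrite leq_add2r).
  have {}b1 : #|bad hab (2 * L ^+ 2) B|%:R <= 2 * 2 ^+ n * expR (- (n%:R * tau ^+ 2 / 8)).
    by apply: b1 => u uL; rewrite normrM expr2 ler_pM// coord_le_of_normsq.
  have {}b0 : #|bad (fun=> 1) (2 * 1) B|%:R <= 2 * 2 ^+ n * expR (- (n%:R * tau ^+ 2 / 8)).
    by apply: b0 => u uL; rewrite normr1.
  by lra.
apply: (@le_trans _ _ #|\bigcup_(B in G) badB B|%:R); last first.
  apply: (@le_trans _ _ (\sum_(B in G) #|badB B|%:R)).
    rewrite -natr_sum ler_nat.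
    elim/big_rec2: _ => [|B m S _ h]; first by rewrite cards0.
    by apply: leq_trans (leq_card_setU _ _) _; rewrite leq_add2l.
  apply: (le_trans (ler_sum _ card_badB)); rewrite sumr_const -[leLHS]mulr_natl.
  rewrite ler_wpM2r ?ler_nat ?mulr_ge0 ?exprn_ge0 ?expR_ge0//.
  apply: (leq_trans (@card_ball_patterns _ _ _ z G _)) => [B|].
    by rewrite inE => /asboolP[q [rho [_ BE]]]; exists q, rho.
  by rewrite card_prod card_ord card_bool muln2.
rewrite ler_nat; apply: subset_leq_card; apply/fintype.subsetP => e.
rewrite inE => /asboolP[q [rho [rhoL eL]]].
have BG : pat q rho \in G by rewrite inE; apply/asboolP; exists q, rho.
apply/bigcupP; exists (pat q rho) => //; apply: contraLR eL.
set B := pat q rho; set v := ref B - q.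
rewrite !inE !negb_or -!leNgt => /andP[/andP[/andP[eab ea] eb] e1].
have -> : \sum_i (-1) ^+ e i * (ball_moment a b q rho (z (i, false)) -
      ball_moment a b q rho (z (i, true))) =
    T hab B e + v ord0 b * T (h1 a) B e + v ord0 a * T (h1 b) B e +
    v ord0 a * v ord0 b * T (fun=> 1) B e.
  have gE j : ball_moment a b q rho (z j) = (j \in B)%:R * hab (z j - ref B) +
      v ord0 b * ((j \in B)%:R * h1 a (z j - ref B)) +
      v ord0 a * ((j \in B)%:R * h1 b (z j - ref B)) +
      v ord0 a * v ord0 b * ((j \in B)%:R * 1).
    rewrite /ball_moment -[normsq _ <= _]/(normsq (z j - q) <= rho).
    have -> : (j \in B) = (normsq (z j - q) <= rho) by rewrite inE.
    by rewrite /hab /h1 !mxE; ring.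
  rewrite /T !mulr_sumr -!big_split/=; apply: eq_bigr => i _.
  by rewrite !gE; ring.
(* An empty trace gives no control of [v], but then all four sums vanish. *)
have [B0|/set0Pn[j jB]] := eqVneq B finset.set0.
  have T0 h : T h B e = 0 by rewrite /T big1// => i _; rewrite B0 !inE !mul0r subrr mulr0.
  rewrite !T0 !mulr0 !addr0 normr0 !mulr_ge0//; exact: sqr_ge0.
(* A sample point in the trace lies within [L] of both centers. *)
have vL c : `|v ord0 c| <= 2 * L.
  have -> : v ord0 c = (z j - q) ord0 c - (z j - ref B) ord0 c.
    by rewrite /v !mxE; ring.
  have -> : 2 * L = L + L by ring.
  rewrite (le_trans (ler_normB _ _))// lerD//.
    by apply: coord_le_of_normsq => //; move: jB; rewrite inE => /le_trans; apply.
  by apply: coord_le_of_normsq => //; exact: normB.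
have L20 := sqr_ge0 L.
rewrite (le_trans (ler_normD _ _))// (le_trans (lerD (ler_normD _ _) (lexx _)))//.
rewrite (le_trans (lerD (lerD (ler_normD _ _) (lexx _)) (lexx _)))// !normrM.
have va0 := normr_ge0 (v ord0 a); have vb0 := normr_ge0 (v ord0 b).
have k1 : `|v ord0 b| * `|T (h1 a) B e| <= 2 * L * (2 * L * (n%:R * tau)) by rewrite ler_pM.
have k2 : `|v ord0 a| * `|T (h1 b) B e| <= 2 * L * (2 * L * (n%:R * tau)) by rewrite ler_pM.
have k3 : `|v ord0 a| * `|v ord0 b| * `|T (fun=> 1) B e| <= 2 * L * (2 * L) * (2 * 1 * (n%:R * tau)).
  by rewrite ler_pM ?mulr_ge0// ler_pM.
(* The constant 18 is 2 + 4 + 4 + 8, one summand for each of the four sums. *)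
apply: (le_trans (lerD (lerD (lerD eab k1) k2) k3)).
by rewrite le_eqVlt; apply/orP; left; apply/eqP; ring.
Qed.

Local Open Scope classical_set_scope.

(** * Laws of finite families *)

Section rectangles.
Context (R : realType) (d d' : measure_display) (T : measurableType d)
  (T' : measurableType d') (P : probability T R) (I : finType).

(** A pi-system generating the product sigma-algebra on families indexed by the finite type [I]. *)
Definition rectangles : set (set (I -> T')) :=
  [set [set f | forall i, A i (f i)] | A in [set A | forall i, measurable (A i)]].

Notation Z := (g_sigma_algebraType rectangles).

Lemma rectangles_setI : setI_closed rectangles.
Proof.
move=> _ _ [A mA <-] [B mB <-]; exists (fun i => A i `&` B i).
  by move=> i; exact: measurableI.
by apply/seteqP; split=> [f /= h|f /= [h1 h2] i];
  [split=> i; have [] := h i|split].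
Qed.

Lemma rectangles_setT : rectangles setT.
Proof. by exists (fun=> setT) => //; apply/seteqP; split. Qed.

Lemma measurable_rectangle_coord i : measurable_fun setT (fun f : Z => f i).
Proof.
move=> _ A mA; rewrite setTI; apply: sub_sigma_algebra.
exists (fun j => if j == i then A else setT) => [j|]; first by case: ifP.
apply/seteqP; split=> f /= h; first by have := h i; rewrite eqxx.
by move=> j; case: eqP => [->|].
Qed.

Lemma measurable_rectangle_fun (X : I -> T -> T') :
  (forall i, measurable_fun setT (X i)) ->
  measurable_fun setT (fun w => (fun i => X i w) : Z).
Proof.
move=> mX; apply: (@measurability _ _ T Z setT _ rectangles) => // _ [_ [A mA <-] <-].
rewrite setTI (_ : _ @^-1` _ = \bigcap_(i in [set: I]) (X i @^-1` A i)).
  apply: fin_bigcap_measurable => // i _; rewrite -[X in measurable X]setTI.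
  exact: mX.
by apply/seteqP; split=> w /= h i //=; exact: h.
Qed.

Lemma pushforward_measureP d1 d2 (T1 : measurableType d1) (T2 : measurableType d2)
    (m : {measure set T1 -> \bar R}) (f : T1 -> T2) : measurable_fun setT f ->
  exists m' : {measure set T2 -> \bar R}, forall A, m' A = m (f @^-1` A).
Proof. by move=> mf; unshelve eexists (pushforward m f). Qed.

(** The pi-lambda theorem; [m1] being finite, the constant sequence [setT] serves as the exhausting
    cover. *)
Lemma measure_unique_rectangles (m1 m2 : {measure set Z -> \bar R}) :
  (m1 setT < +oo)%E ->
  (forall A, rectangles A -> m1 A = m2 A) ->
  forall E, measurable E -> m1 E = m2 E.
Proof.
move=> m1oo m12 E mE; apply: (@measure_unique _ R Z rectangles (fun=> setT) _ _ _ _ m1 m2) => //.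
- exact: rectangles_setI.
- by move=> _; exact: rectangles_setT.
- by apply/seteqP; split=> // x _; exists 0%N.
Qed.

Lemma eq_law_rectangles (X Y : I -> T -> T') :
  (forall i, measurable_fun setT (X i)) ->
  (forall i, measurable_fun setT (Y i)) ->
  (forall A : I -> set T', (forall i, measurable (A i)) ->
    P [set w | forall i, A i (X i w)] = P [set w | forall i, A i (Y i w)]) ->
  forall E : set Z, measurable E ->
  P [set w | E (fun i => X i w)] = P [set w | E (fun i => Y i w)].
Proof.
move=> mX mY XY E mE.
have [m1 m1E] := pushforward_measureP P (measurable_rectangle_fun mX).
have [m2 m2E] := pushforward_measureP P (measurable_rectangle_fun mY).
have -> : P [set w | E (fun i => X i w)] = m1 E by rewrite m1E.
have -> : P [set w | E (fun i => Y i w)] = m2 E by rewrite m2E.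
apply: measure_unique_rectangles mE => [|_ [A mA <-]].
  by rewrite m1E (le_lt_trans (probability_le1 P measurableT))// ltry.
by rewrite m1E m2E; exact: XY.
Qed.

End rectangles.

Notation pathType I T' := (g_sigma_algebraType (@rectangles _ T' I)).

(** Meant for [mu] the restriction of [P] to an event about another family, and [c] the probability
    of that event. *)
Lemma product_law_half (R : realType) d d' (T : measurableType d)
    (T' : measurableType d') (P : probability T R) (I : finType)
    (X : I -> T -> T') (mu : {measure set T -> \bar R}) (c : R) :
  (forall i, measurable_fun setT (X i)) -> (mu setT < +oo)%E -> 0 <= c ->
  (forall A : I -> set T', (forall i, measurable (A i)) ->
    mu [set w | forall i, A i (X i w)] = c%:E * P [set w | forall i, A i (X i w)])%E ->
  forall E : set (pathType I T'), measurable E ->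
  (mu [set w | E (fun i => X i w)] = c%:E * P [set w | E (fun i => X i w)])%E.
Proof.
move=> mX muoo c0 h E mE.
have [m1 m1E] := pushforward_measureP mu (measurable_rectangle_fun mX).
have [m2 m2E] := pushforward_measureP (mscale (NngNum c0) P) (measurable_rectangle_fun mX).
have -> : mu [set w | E (fun i => X i w)] = m1 E by rewrite m1E.
have -> : (c%:E * P [set w | E (fun i => X i w)])%E = m2 E by rewrite m2E.
apply: measure_unique_rectangles mE => [|_ [A mA <-]].
  by rewrite m1E preimage_setT.
by rewrite m1E m2E; exact: h.
Qed.

(** Factorization passes from rectangles to all events one family at a time: [product_law_half] is
    applied first to [X] with [F] fixed, then to [Y] with a rectangle of [X] fixed. *)
Lemma independent_halves (R : realType) d d' (T : measurableType d)
    (T' : measurableType d') (P : probability T R) (I J : finType)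
    (X : I -> T -> T') (Y : J -> T -> T') :
  (forall i, measurable_fun setT (X i)) ->
  (forall j, measurable_fun setT (Y j)) ->
  (forall (A : I -> set T') (B : J -> set T'),
    (forall i, measurable (A i)) -> (forall j, measurable (B j)) ->
    P [set w | (forall i, A i (X i w)) /\ forall j, B j (Y j w)] =
    P [set w | forall i, A i (X i w)] * P [set w | forall j, B j (Y j w)])%E ->
  forall (E : set (pathType I T')) (F : set (pathType J T')),
  measurable E -> measurable F ->
  P ([set w | E (fun i => X i w)] `&` [set w | F (fun j => Y j w)]) =
  (P [set w | E (fun i => X i w)] * P [set w | F (fun j => Y j w)])%E.
Proof.
move=> mX mY XY E F mE mF.
have mXE E' : measurable E' -> measurable [set w | E' ((fun i => X i w) : pathType I T')].
  by move=> mE'; rewrite -[X in measurable X]setTI; exact: measurable_rectangle_fun.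
have mYF F' : measurable F' -> measurable [set w | F' ((fun i => Y i w) : pathType J T')].
  by move=> mE'; rewrite -[X in measurable X]setTI; exact: measurable_rectangle_fun.
have Poo D (mD : measurable D) : (mrestr P mD setT < +oo)%E.
  by rewrite /mrestr setTI (le_lt_trans (probability_le1 P mD))// ltry.
rewrite muleC -(fineK (fin_num_measure P _ (mYF F mF))).
pose c (D : set T) := fine (P D).
have c0 D : 0 <= c D by rewrite fine_ge0.
have := @product_law_half R _ _ T T' P I X (mrestr P (mYF F mF)) (c [set w | F (fun j => Y j w)]) mX (Poo _ _) (c0 _).
apply=> // A mA.
have mA' : measurable [set w | forall i, A i (X i w)].
  apply: (mXE [set f | forall i, A i (f i)]).
  by apply: sub_sigma_algebra; exists A.
rewrite /c muleC fineK ?fin_num_measure//; last exact: mYF.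
rewrite -[in RHS](fineK (fin_num_measure P _ mA')) /= /mrestr setIC.
have := @product_law_half R _ _ T T' P J Y (mrestr P mA') (c [set w | forall i, A i (X i w)]) mY (Poo _ _) (c0 _).
apply=> // B mB.
have mB' : measurable [set w | forall i, B i (Y i w)].
  apply: (mYF [set f | forall i, B i (f i)]).
  by apply: sub_sigma_algebra; exists B.
by rewrite /c fineK ?fin_num_measure//= /mrestr setIC -XY.
Qed.

(** * Consequences of independence *)

Lemma bounded_integrable (R : realType) d (T : measurableType d)
    (mu : {measure set T -> \bar R}) (f : T -> R) (M : R) :
  (mu setT < +oo)%E -> measurable_fun setT f -> (forall x, `|f x| <= M) ->
  mu.-integrable setT (EFin \o f).
Proof.
move=> muoo mf fM; apply: measurable_bounded_integrable => //.
exists M; split; first exact: num_real.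
by move=> N MN x _ /=; rewrite (le_trans (fM x))// ltW.
Qed.

Lemma measurable_fun_sumR (R : realType) d (T : measurableType d) (I : Type)
    (s : seq I) (Q : pred I) (f : I -> T -> R) :
  (forall i, measurable_fun setT (f i)) ->
  measurable_fun setT (fun x => \sum_(i <- s | Q i) f i x).
Proof.
move=> mf; elim: s => [|i s IH].
  by under eq_fun do rewrite big_nil; exact: measurable_cst.
under eq_fun do rewrite big_cons.
by case: (Q i) => //; exact: measurable_funD.
Qed.

Lemma measurable_lt_set (R : realType) d (T : measurableType d) (f g : T -> R) :
  measurable_fun setT f -> measurable_fun setT g ->
  measurable [set x | f x < g x].
Proof.
move=> mf mg.
have h : measurable_fun setT (fun x => f x < g x) by exact: measurable_fun_ltr.
by have := h measurableT [set true] I; rewrite setTI.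
Qed.

Lemma measurable_lt_norm_set (R : realType) d (T : measurableType d)
    (c : R) (f : T -> R) :
  measurable_fun setT f -> measurable [set x | c < `|f x|].
Proof.
by move=> mf; apply: measurable_lt_set => //; exact: measurableT_comp.
Qed.

Lemma probability_lty (R : realType) d (T : measurableType d)
  (P : probability T R) (A : set T) : measurable A -> (P A < +oo)%E.
Proof. by move=> mA; rewrite (le_lt_trans (probability_le1 P mA))// ltry. Qed.

Section iid.
Context (R : realType) (d d' : measure_display) (T : measurableType d)
  (T' : measurableType d') (P : probability T R) (alpha : probability T' R).

Lemma iid_rectangle (y : nat -> {RV P >-> T'}) (I : finType) (iota : I -> nat)
    (A : I -> set T') :
  iid y alpha -> injective iota -> (forall i, measurable (A i)) ->
  P [set w | forall i, A i (y (iota i) w)] = (\prod_i alpha (A i))%E.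
Proof.
move=> [ind law] inj mA.
(* Independence is stated for sets indexed by [nat], so [A] is transported along [iota] and
   completed by [setT] off its image. *)
pose B k := if [pick i | iota i == k] is Some i then A i else setT.
have Biota i : B (iota i) = A i.
  rewrite /B; case: pickP => [j /eqP/inj ->//|/(_ i)]; by rewrite eqxx.
have mB k : measurable (B k) by rewrite /B; case: pickP.
have -> : [set w | forall i, A i (y (iota i) w)] =
    \bigcap_(k in [set` map iota (enum I)]) (y k @^-1` B k).
  apply/seteqP; split=> [w /= h _ /mapP[i _ ->]|w /= h i].
    by rewrite /= Biota; exact: h.
  by rewrite -Biota; apply: (h (iota i)); apply/mapP; exists i; rewrite ?mem_enum.
rewrite ind //; last by rewrite map_inj_uniq ?enum_uniq.
rewrite big_map -big_enum/=.
by apply: eq_bigr => i _; rewrite Biota -(law (iota i)).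
Qed.

(** The joint law is the product measure by uniqueness, and Fubini exhibits the vanishing mean of
    [h] as inner integral. *)
Lemma expectation_mul_independent (X Y : T -> T') (h : T' -> R) (M : R) :
  measurable_fun setT X -> measurable_fun setT Y ->
  (forall A B, measurable A -> measurable B ->
    P (X @^-1` A `&` Y @^-1` B) = alpha A * alpha B)%E ->
  measurable_fun setT h -> (forall x, `|h x| <= M) ->
  (\int[alpha]_x (h x)%:E = 0)%E ->
  (\int[P]_w (h (X w) * h (Y w))%:E = 0)%E.
Proof.
move=> mX mY ind mh hM h0.
have mXY : measurable_fun setT (fun w => (X w, Y w)) by exact: measurable_fun_pair.
have [m' m'E] := pushforward_measureP P mXY.
pose F (z : T' * T') := (h z.1 * h z.2).
have mF : measurable_fun setT F.
  by apply: measurable_funM; apply: measurableT_comp.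
have M0 : 0 <= M by rewrite (le_trans _ (hM point)).
have FM z : `|F z| <= M * M by rewrite normrM ler_pM.
have -> : (\int[P]_w (h (X w) * h (Y w))%:E = \int[m']_z (F z)%:E)%E.
  rewrite (eq_measure_integral (pushforward P (fun w => (X w, Y w)))) => [|A mA _]; last exact: m'E.
  rewrite integral_pushforward//; first exact/measurable_EFinP.
  apply: (@bounded_integrable _ _ _ P (F \o (fun w => (X w, Y w))) (M * M)) => //.
    exact: probability_lty.
    exact: measurableT_comp.
  by move=> w; exact: FM.
have -> : (\int[m']_z (F z)%:E = \int[(alpha \x alpha)%E]_z (F z)%:E)%E.
  apply: eq_measure_integral => A mA _; apply/esym.
  apply: product_measure_unique => // A1 A2 mA1 mA2.
  by rewrite m'E -ind.
have iF : (alpha \x alpha)%E.-integrable setT (EFin \o F).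
  apply: (@bounded_integrable _ _ _ _ _ (M * M)) => //.
  have e : (alpha \x alpha)%E setT = 1%E.
    rewrite -setXTT; apply: eq_trans (product_measure1E _ _ measurableT measurableT) _.
    by rewrite /= !probability_setT mule1.
  apply: (@le_lt_trans _ _ 1%E); last exact: ltry.
  by rewrite le_eqVlt; apply/orP; left; apply/eqP.
rewrite -(integral12_prod_meas1 iF) integral0_eq// => x _.
rewrite /fubini_F /F/=; under eq_integral do rewrite EFinM.
rewrite integralZl// ?h0 ?mule0//.
by apply: (bounded_integrable _ mh hM); exact: probability_lty.
Qed.

(** Pairwise independence removes the cross terms of the second moment; each of the [n] diagonal
    terms is at most [(2 * M) ^+ 2], as the centered function is bounded by [2 * M]. *)
Lemma chebyshev_mean (n : nat) (Y : 'I_n -> T -> T') (g : T' -> R) (M s : R) :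
  (forall i, measurable_fun setT (Y i)) ->
  (forall i j A B, i != j -> measurable A -> measurable B ->
    P (Y i @^-1` A `&` Y j @^-1` B) = alpha A * alpha B)%E ->
  measurable_fun setT g -> (forall x, `|g x| <= M) -> 0 < s ->
  (P [set w | (s < `|\sum_i g (Y i w) - n%:R * \int[alpha]_x g x|)%R] <=
    (n%:R * (2 * M) ^+ 2 / s ^+ 2)%:E)%E.
Proof.
move=> mY ind mg gM s0; set mu := \int[alpha]_x g x.
have ig : alpha.-integrable setT (EFin \o g).
  by apply: (bounded_integrable _ mg gM); exact: probability_lty.
have muM : `|mu| <= M.
  rewrite (le_trans (le_normr_Rintegral measurableT ig))//.
  have -> : M = \int[alpha]_x cst M x.
    by rewrite Rintegral_cst//= probability_setT mulr1.
  apply: le_Rintegral => //.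
  - exact: integrable_norm.
  - exact: finite_measure_integrable_cst.
pose h x := g x - mu.
have mh : measurable_fun setT h by exact: measurable_funB.
have hM x : `|h x| <= 2 * M.
  rewrite (le_trans (ler_normB _ _))//.
  have -> : 2 * M = M + M by ring.
  by apply: lerD; [exact: gM|exact: muM].
have h0 : (\int[alpha]_x (h x)%:E = 0)%E.
  rewrite /h; under eq_integral do rewrite EFinB.
  rewrite integralB_EFin//; last exact: finite_measure_integrable_cst.
  rewrite integral_cst//= probability_setT mule1 /mu /Rintegral fineK ?subee//.
    exact: integrable_fin_num.
  exact: integrable_fin_num.
have M0 : 0 <= 2 * M by rewrite (le_trans _ (hM point)).
pose S w := \sum_i h (Y i w).
have SE w : S w = \sum_i g (Y i w) - n%:R * mu.
  rewrite /S sumrB; congr (_ - _).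
  by rewrite sumr_const card_ord mulr_natl.
have mhY i : measurable_fun setT (h \o Y i) by exact: measurableT_comp.
have mS : measurable_fun setT S.
  by apply: measurable_fun_sumR => i; exact: mhY.
have mE : measurable [set w | s < `|S w|] by exact: measurable_lt_norm_set.
under eq_set do rewrite -SE.
have key : (\int[P]_w (S w ^+ 2)%:E <= (n%:R * (2 * M) ^+ 2)%:E)%E.
  have ihh i j : P.-integrable setT (fun w => (h (Y i w) * h (Y j w))%:E).
    apply: (@bounded_integrable _ _ _ P (fun w => h (Y i w) * h (Y j w)) ((2 * M) * (2 * M))).
    - exact: probability_lty.
    - by apply: measurable_funM; exact: mhY.
    - by move=> w; rewrite normrM ler_pM.
  have -> : (\int[P]_w (S w ^+ 2)%:E =
      \sum_i \sum_j \int[P]_w (h (Y i w) * h (Y j w))%:E)%E.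
    under eq_bigr => i _ do rewrite -integral_sum//.
    rewrite -integral_sum//; last by move=> i; exact: integrable_sum.
    apply: eq_integral => w _; rewrite expr2 /S mulr_suml -sumEFin.
    by apply: eq_bigr => i _; rewrite mulr_sumr -sumEFin.
  have -> : (n%:R * (2 * M) ^+ 2)%:E = (\sum_(i < n) ((2 * M) ^+ 2)%:E)%E.
    by rewrite sumEFin sumr_const card_ord mulr_natl.
  apply: lee_sum => i _; rewrite (bigD1 i)//= big1 => [|j ji]; last first.
    apply: (@expectation_mul_independent _ _ _ (2 * M)) => // A B mA mB.
    by rewrite ind// eq_sym.
  rewrite adde0 -[leRHS]mule1 -(probability_setT P) -integral_cst//.
  apply: ge0_le_integral => //.
  - by move=> w _; rewrite lee_fin -expr2 sqr_ge0.
  - by apply/measurable_EFinP; apply: measurable_funM; exact: mhY.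
  - move=> w _; rewrite lee_fin -expr2 -(real_normK (num_real (h _))).
    by rewrite ler_pXn2r// nnegrE.
have h2 : ((s ^+ 2)%:E * P [set w | (s < `|S w|)%R] <= \int[P]_w (S w ^+ 2)%:E)%E.
  rewrite -[X in (_ * P X)%E]setIT -integral_indic// -integralZl//; last first.
    exact: integrable_indic.
  apply: ge0_le_integral => //.
  - by move=> w _; rewrite -EFinM lee_fin mulr_ge0// sqr_ge0.
  - apply/measurable_EFinP; apply: measurable_funM => //.
  - by apply/measurable_EFinP; exact: measurable_funX.
  - move=> w _; rewrite -EFinM lee_fin indicE; case: (boolP (w \in _)) => [|_].
      rewrite inE /= mulr1 => /ltW sS; rewrite -(real_normK (num_real (S w))).
      by rewrite ler_pXn2r// nnegrE// ltW.
    by rewrite mulr0 sqr_ge0.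
have := le_trans h2 key.
rewrite -(fineK (fin_num_measure P _ mE)) -EFinM !lee_fin mulrC -ler_pdivlMr//.
exact: exprn_gt0.
Qed.

End iid.

(** * Symmetrization *)

Lemma measurable_existsP d (T : measurableType d) (Q : nat -> set T) :
  (forall k, measurable (Q k)) -> measurable [set x | exists k, Q k x].
Proof.
move=> mQ; rewrite (_ : [set _ | _] = \bigcup_k Q k).
  exact: bigcupT_measurable.
by apply/seteqP; split=> [x [k Qk]|x [k _ Qk]]; exists k.
Qed.

Section symmetrization.
Context (R : realType) (d d' : measure_display) (T : measurableType d)
  (T' : measurableType d') (P : probability T R) (alpha : probability T' R)
  (y : nat -> {RV P >-> T'}) (n : nat) (g : nat -> T' -> R) (M t delta : R).
Hypotheses (iidy : iid y alpha) (mg : forall k, measurable_fun setT (g k))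
  (gM : forall k x, `|g k x| <= M) (n0 : (0 < n)%N) (t0 : 0 < t)
  (tM : 32 * M ^+ 2 <= n%:R * t ^+ 2).
Hypothesis card_delta : forall z : 'I_n * bool -> T',
  #|[set e : {ffun 'I_n -> bool} | `[< exists k, n%:R * (t / 2) <
    `|\sum_i (-1) ^+ e i * (g k (z (i, false)) - g k (z (i, true)))| >]]%SET|%:R <=
  2 ^+ n * delta.

(** The label [false] designates the sample [y 0, ..., y (n - 1)], and [true] its ghost copy, the
    next [n] variables. *)
Let iota (p : 'I_n * bool) : nat := (p.1 + p.2 * n)%N.

Let iota_inj : injective iota.
Proof.
move=> [i b] [j c]; rewrite /iota/= => e.
have bc : b = c.
  by move: e (ltn_ord i) (ltn_ord j); case: b; case: c => //=;
    rewrite ?mul1n ?mul0n ?addn0 => e hi hj; exfalso;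
    [move: hj; rewrite -e|move: hi; rewrite e]; rewrite ltnNge leq_addl.
by subst c; congr pair; apply: val_inj => /=; apply: (addIn e).
Qed.

Let my k : measurable_fun setT (y k).
Proof. exact: measurable_funPT. Qed.

Let pair_independent k l A B : k != l -> measurable A -> measurable B ->
  P (y k @^-1` A `&` y l @^-1` B) = (alpha A * alpha B)%E.
Proof.
move=> kl mA mB; pose j (b : bool) := if b then l else k.
pose C (b : bool) := if b then B else A.
have mC b : measurable (C b) by case: b.
have inj_j : injective j.
  by case=> [] [] //=; rewrite /j => e; rewrite e eqxx in kl.
have := iid_rectangle iidy inj_j mC.
rewrite big_bool /C/= muleC => <-; congr (P _).
by apply/seteqP; split=> [w [h1 h2] [] //|w /= h]; split;
  [exact: (h false)|exact: (h true)].
Qed.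

Let mu k := \int[alpha]_x g k x.
Let dev (k : nat) (f : 'I_n -> T') := \sum_i g k (f i) - n%:R * mu k.

Let mdev k : measurable_fun (setT : set (pathType 'I_n T')) (dev k).
Proof.
apply: measurable_funB => //; apply: measurable_fun_sumR => i.
by apply: (measurableT_comp (mg k)); exact: measurable_rectangle_coord.
Qed.

Let good k : set (pathType 'I_n T') := ~` [set f | n%:R * (t / 2) < `|dev k f|].
Let bad k : set (pathType 'I_n T') := [set f | n%:R * t < `|dev k f|].

Let mgood k : measurable (good k).
Proof. by apply: measurableC; exact: (measurable_lt_norm_set _ (mdev k)). Qed.

Let mbad k : measurable (bad k).
Proof. exact: (measurable_lt_norm_set _ (mdev k)). Qed.

(** Splits the bad event into disjoint pieces, according to the least index that deviates. *)
Let first := seqDU bad.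

Let mfirst k : measurable (first k).
Proof. by apply: measurableD => //; exact: bigsetU_measurable. Qed.

Let X w : pathType 'I_n T' := fun i => y i w.
Let Y w : pathType 'I_n T' := fun i => y (i + n) w.

Let half_independent E F : measurable E -> measurable F ->
  P ([set w | E (X w)] `&` [set w | F (Y w)]) =
  (P [set w | E (X w)] * P [set w | F (Y w)])%E.
Proof.
apply: (@independent_halves R _ _ T T' P 'I_n 'I_n (fun i => y i) (fun i => y (i + n))) => // A B mA mB.
pose C (p : 'I_n * bool) := if p.2 then B p.1 else A p.1.
have mC p : measurable (C p) by case: p => i []; [exact: mB|exact: mA].
have eA := @iid_rectangle R _ _ T T' P alpha y 'I_n (fun i => i) A iidy (@ord_inj n) mA.
have inj' : injective (fun i : 'I_n => i + n)%N by move=> i j /addIn/ord_inj.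
have eB := @iid_rectangle R _ _ T T' P alpha y 'I_n (fun i => i + n)%N B iidy inj' mB.
rewrite eA eB; have := iid_rectangle iidy iota_inj mC.
rewrite (_ : [set w | forall i, C i (y (iota i) w)] =
  [set w | (forall i : 'I_n, A i (y i w)) /\ (forall j : 'I_n, B j (y (j + n) w))]).
  move=> ->; rewrite -big_split/=.
  rewrite -(pair_bigA _ (fun i b => alpha (C (i, b))))/=.
  by apply: eq_bigr => i _; rewrite big_bool /C/= muleC.
apply/seteqP; split => [w /= h|w /= [h1 h2] [i []]].
- split=> i; first by have := h (i, false); rewrite /C /iota/= addn0.
  by have := h (i, true); rewrite /C /iota/= mul1n.
- by rewrite /C /iota/= mul1n.
- by rewrite /C /iota/= addn0.
Qed.

(** Chebyshev at level [n * t / 2] bounds the failure probability by [16 * M ^ 2 / (n * t ^ 2)], and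
    [tM] makes this at most 1/2. *)
Let good_half k : ((1 / 2)%:E <= P [set w | good k (Y w)])%E.
Proof.
have s0 : 0 < n%:R * (t / 2) by rewrite mulr_gt0 ?divr_gt0 ?ltr0n.
have := @chebyshev_mean R _ _ T T' P alpha n (fun i => y (i + n)) (g k) M (n%:R * (t / 2))
  (fun i => my _) _ (mg k) (gM k) s0.
have h : (n%:R * (2 * M) ^+ 2 / (n%:R * (t / 2)) ^+ 2 <= 1 / 2)%R.
  rewrite ler_pdivrMr ?exprn_gt0//.
  have n0' : 0 < n%:R :> R by rewrite ltr0n.
  have : n%:R * (32 * M ^+ 2) <= n%:R * (n%:R * t ^+ 2) by rewrite ler_wpM2l// ltW.
  by rewrite !exprMn !expr2; lra.
have mE : measurable [set w | n%:R * (t / 2) < `|dev k (Y w)|].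
  apply: measurable_lt_norm_set; apply: (measurableT_comp (mdev k)).
  by apply: measurable_rectangle_fun => i; exact: my.
have ind i j A B : i != j -> measurable A -> measurable B ->
    P (y (i + n) @^-1` A `&` y (j + n) @^-1` B) = (alpha A * alpha B)%E.
  by move=> ij; apply: pair_independent; rewrite eqn_add2r.
move=> /(_ ind) cheb.
have -> : [set w | good k (Y w)] = ~` [set w | n%:R * (t / 2) < `|dev k (Y w)|] by [].
rewrite probability_setC// -(fineK (fin_num_measure P _ mE)) -EFinB lee_fin.
have : fine (P [set w | n%:R * (t / 2) < `|dev k (Y w)|]) <= 1 / 2.
  by rewrite -lee_fin fineK ?fin_num_measure//; apply: (le_trans cheb); rewrite lee_fin.
by lra.
Qed.

Let sym : set (pathType ('I_n * bool)%type T') :=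
  [set f | exists k, n%:R * (t / 2) <
    `|\sum_i (g k (f (i, false)) - g k (f (i, true)))|].

Let msym : measurable sym.
Proof.
apply: measurable_existsP => k; apply: measurable_lt_norm_set.
apply: measurable_fun_sumR => i.
by apply: measurable_funB; apply: (measurableT_comp (mg k));
  exact: measurable_rectangle_coord.
Qed.

Let Z w : pathType ('I_n * bool)%type T' := fun p => y (iota p) w.

Let mX : measurable_fun setT X.
Proof. by apply: measurable_rectangle_fun => i; exact: my. Qed.

Let mY : measurable_fun setT Y.
Proof. by apply: measurable_rectangle_fun => i; exact: my. Qed.

Let mpre d1 (U : measurableType d1) (f : T -> U) (A : set U) :
  measurable_fun setT f -> measurable A -> measurable [set w | A (f w)].
Proof. by move=> mf mA; rewrite -[X in measurable X]setTI; exact: mf. Qed.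

Let mXfirst k : measurable [set w | first k (X w)].
Proof. by apply: (mpre mX). Qed.

Let mYgood k : measurable [set w | good k (Y w)].
Proof. by apply: (mpre mY). Qed.

Let mZ : measurable_fun setT Z.
Proof. by apply: measurable_rectangle_fun => i; exact: my. Qed.

(* The first index at which the first half deviates is a function of that half,
   so the ghost half is concentrated at that index independently of it. *)
Let bad_le_sym : (P [set w | exists k, (n%:R * t < `|dev k (X w)|)%R] <=
  2%:E * P [set w | sym (Z w)])%E.
Proof.
have tfirst : trivIset setT (fun k => [set w | first k (X w)]).
  apply/trivIsetP => i j _ _ ij; apply/seteqP; split => // w [/= h1 h2].
  have /trivIsetP/(_ i j I I ij) := @trivIset_seqDU _ bad.
  by move=> /seteqP[/(_ (X w)) h _]; apply: h.
have -> : [set w | exists k, (n%:R * t < `|dev k (X w)|)%R] =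
    \bigcup_k [set w | first k (X w)].
  have e := seqDU_bigcup_eq bad.
  apply/seteqP; split => [w [k bk]|w [k _ [bk _]]]; last by exists k.
  have : (\bigcup_k bad k) (X w) by exists k.
  by rewrite e => -[j _ fj]; exists j.
rewrite measure_bigcup//.
apply: (@le_trans _ _ (\sum_(0 <= k <oo | k \in setT)
    (2%:E * P ([set w | first k (X w)] `&` [set w | good k (Y w)])))%E).
  apply: lee_nneseries => // k _; rewrite half_independent//.
  rewrite muleCA -[leLHS]mule1 lee_wpmul2l//.
  have := good_half k; rewrite -(fineK (fin_num_measure P _ (mYgood k))).
  by rewrite -EFinM !lee_fin; lra.
rewrite nneseriesZl// lee_wpmul2l// -measure_bigcup//; last 2 first.
- by move=> k _; exact: measurableI.
- by apply: trivIset_setIr.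
apply: le_measure; rewrite ?inE.
- by apply: bigcupT_measurable => k; exact: measurableI.
- exact: (mpre mZ).
- move=> w [k _ [[/= bk _] gk]]; exists k.
  move: bk gk; rewrite /bad /good/= => bk /negP; rewrite -leNgt => gk.
  have -> : \sum_i (g k (Z w (i, false)) - g k (Z w (i, true))) =
      dev k (X w) - dev k (Y w).
    rewrite /dev sumrB /Z /X /Y /iota/=.
    under eq_bigr do rewrite addn0.
    under [X in _ - X = _]eq_bigr do rewrite mul1n.
    by ring.
  apply: lt_le_trans (lerB_dist _ _).
  by move: bk gk; rewrite mulrA; lra.
Qed.

Let swap (e : {ffun 'I_n -> bool}) (p : 'I_n * bool) := (p.1, p.2 (+) e p.1).

(** Exchanging sample points with their ghosts permutes the i.i.d. family, hence preserves its law
    on rectangles. *)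
Let sym_swap e : P [set w | sym (Z w)] = P [set w | sym (Z w \o swap e)].
Proof.
have swap_inj : injective (swap e).
  move=> [i b] [j c] [-> h]; congr pair; move: h; exact: addIb.
apply: (@eq_law_rectangles R _ _ T T' P _ (fun p => y (iota p))
  (fun p => y (iota (swap e p)))) => // A mA.
rewrite (iid_rectangle iidy iota_inj mA).
by rewrite (iid_rectangle iidy (inj_comp iota_inj swap_inj) mA).
Qed.

(** The [2 ^ n] swapped events have equal probability. The sum of these is the integral of the
    number of swaps for which the event occurs, which [card_delta] bounds pointwise. *)
Let sym_le : (P [set w | sym (Z w)] <= delta%:E)%E.
Proof.
have mS e : measurable [set w | sym (Z w \o swap e)].
  apply: (mpre (f := fun w => (Z w \o swap e : pathType ('I_n * bool)%type T'))) => //.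
  by apply: measurable_rectangle_fun => i; exact: my.
have : (\sum_(e : {ffun 'I_n -> bool}) P [set w | sym (Z w \o swap e)] <=
    (2 ^+ n * delta)%:E)%E.
  rewrite -[leRHS]mule1 -(probability_setT P) -integral_cst//.
  under eq_bigr => e _ do rewrite -[X in P X]setIT -integral_indic//.
  rewrite -ge0_integral_sum//; last first.
    by move=> e; apply/measurable_EFinP; exact: measurable_indic.
  apply: ge0_le_integral => //.
  - by move=> w _; apply: sume_ge0 => e _; rewrite lee_fin.
  - by apply: emeasurable_sum => e; apply/measurable_EFinP; exact: measurable_indic.
  move=> w _; rewrite sumEFin lee_fin; apply: le_trans (card_delta (Z w)).
  rewrite -sum1_card natr_sum [leRHS]big_mkcond/=.
  apply: ler_sum => e _; rewrite indicE inE.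
  rewrite (_ : (w \in _) = `[< sym (Z w \o swap e) >]); last first.
    by apply/idP/asboolP; rewrite inE.
  case: asboolP => [[k hk]|_]; last by case: ifP.
  case: asboolP => // -[]; exists k.
  rewrite (eq_bigr (fun i => g k ((Z w \o swap e) (i, false)) -
    g k ((Z w \o swap e) (i, true))))// => i _ /=.
  (* Swapping the pair [i] reverses the sign of its difference, which is where the factor
     [(-1) ^+ e i] comes from. *)
  by rewrite /swap /=; case: (e i) => /=; rewrite ?expr1 ?expr0 ?mul1r// mulN1r opprB.
under eq_bigr => e _ do rewrite -(sym_swap e).
rewrite -(fineK (fin_num_measure P _ (mpre mZ msym))) sumEFin sumr_const.
rewrite card_ffun card_bool card_ord.
by rewrite !lee_fin -[leLHS]mulr_natl natrX ler_pM2l// exprn_gt0.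
Qed.

Lemma symmetrization :
  (P [set w | exists k, (n%:R * t <
    `|\sum_(i < n) g k (y i w) - n%:R * \int[alpha]_x g k x|)%R] <=
   (2 * delta)%:E)%E.
Proof.
apply: (le_trans bad_le_sym).
by rewrite EFinM lee_wpmul2l// sym_le.
Qed.

End symmetrization.

(** * Convergence of ball moments *)

Lemma cvg_sumR (R : realType) (T : Type) (F : set_system T) (FF : Filter F)
    (I : Type) (s : seq I) (Q : pred I) (f : I -> T -> R) (l : I -> R) :
  (forall i, f i x @[x --> F] --> l i) ->
  \sum_(i <- s | Q i) f i x @[x --> F] --> \sum_(i <- s | Q i) l i.
Proof.
move=> fl; elim: s => [|i s IH].
  by under eq_fun do rewrite big_nil; rewrite big_nil; exact: cvg_cst.
under eq_fun do rewrite big_cons; rewrite big_cons.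
by case: (Q i) => //; exact: cvgD.
Qed.

Section moments.
Context (R : realType) (d : nat).
Implicit Types (q x y : 'rV[R]_d) (rho : R).

Lemma coord_cvg (T : Type) (F : set_system T) (FF : Filter F)
    (u : T -> 'rV[R]_d) x j :
  u t @[t --> F] --> x -> (u t ord0 j : R) @[t --> F] --> (x ord0 j : R).
Proof.
move=> ux; apply: (cvg_comp u (fun M : 'rV[R]_d => M ord0 j) ux).
exact: coord_continuous.
Qed.

Lemma coordB_cvg (T : Type) (F : set_system T) (FF : Filter F)
    (u : T -> 'rV[R]_d) x y j :
  u t @[t --> F] --> x ->
  ((y - u t) ord0 j : R) @[t --> F] --> ((y - x) ord0 j : R).
Proof.
move=> ux; under eq_fun do rewrite !mxE; rewrite !mxE.
by apply: cvgB; [exact: cvg_cst|exact: coord_cvg].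
Qed.

Lemma normsqB_cvg (T : Type) (F : set_system T) (FF : Filter F)
    (u : T -> 'rV[R]_d) x y :
  u t @[t --> F] --> x -> normsq (y - u t) @[t --> F] --> normsq (y - x).
Proof.
by move=> ux; apply: cvg_sumR => j; rewrite expr2;
  under eq_fun do rewrite expr2; apply: cvgM; exact: coordB_cvg.
Qed.

Lemma measurable_coordB q j : measurable_fun setT (fun y => (y - q) ord0 j).
Proof.
apply: (@eq_measurable_fun _ _ _ _ setT (fun y => y ord0 j - q ord0 j)).
  by move=> y _; rewrite !mxE.
by apply: measurable_funB => //; exact: measurable_coord.
Qed.

Lemma measurable_normsqB q : measurable_fun setT (fun y => normsq (y - q)).
Proof.
by apply: measurable_fun_sumR => j; apply: measurable_funX; exact: measurable_coordB.
Qed.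

Lemma measurable_ball_moment a b q rho :
  measurable_fun setT (ball_moment a b q rho).
Proof.
apply: measurable_funM.
  by apply: measurable_funM; exact: measurable_coordB.
rewrite (_ : (fun _ => _) = \1_[set y | normsq (y - q) <= rho]).
  apply: measurable_indic; rewrite (_ : mkset _ = ~` [set y | rho < normsq (y - q)]).
    by apply: measurableC; apply: measurable_lt_set => //; exact: measurable_normsqB.
  by apply/seteqP; split=> y /=; rewrite leNgt => /negP.
by apply/funext => y; rewrite indicE; congr (_%:R); congr nat_of_bool;
  apply/idP/idP; rewrite inE.
Qed.

Lemma ball_moment_bound a b q rho B y :
  0 <= B -> rho <= B -> `|ball_moment a b q rho y| <= B.
Proof.
move=> B0 rB; rewrite /ball_moment; case: (boolP (_ <= rho)) => [h|_]; last by rewrite mulr0 normr0.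
rewrite mulr1 normrM; set u := y - q.
have ua := sqr_coord_le_normsq u a; have ub := sqr_coord_le_normsq u b.
have hB : normsq u <= B := le_trans h rB.
rewrite -(real_normK (num_real (u ord0 a))) in ua.
rewrite -(real_normK (num_real (u ord0 b))) in ub.
by have := sqr_ge0 (`|u ord0 a| - `|u ord0 b|); rewrite sqrrB; nra.
Qed.

Variable alpha : probability 'rV[R]_d R.

Lemma integrable_ball_moment a b q rho :
  alpha.-integrable setT (EFin \o ball_moment a b q rho).
Proof.
apply: (@bounded_integrable _ _ _ _ _ `|rho|).
- exact: probability_lty.
- exact: measurable_ball_moment.
- by move=> y; apply: ball_moment_bound => //; exact: ler_norm.
Qed.

(** The indicator of the ball is discontinuous, so membership of [y] is assumed to be eventually
    that of the limit ball. *)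
Lemma ball_moment_cvg a b (q_ : nat -> 'rV[R]_d) (rho_ : nat -> R) x rho y :
  q_ n @[n --> \oo] --> x ->
  (\forall n \near \oo, (normsq (y - q_ n) <= rho_ n) = (normsq (y - x) <= rho)) ->
  ball_moment a b (q_ n) (rho_ n) y @[n --> \oo] --> ball_moment a b x rho y.
Proof.
move=> qx e; apply: cvgM.
  by apply: cvgM; exact: coordB_cvg.
by apply: cvg_near_cst; apply: filterS e => n ->.
Qed.

(** Dominated convergence. The condition on membership holds everywhere for the approximating
    rational balls, and off a null sphere for moving centers of fixed radius. *)
Lemma Rintegral_ball_moment_cvg a b (q_ : nat -> 'rV[R]_d) (rho_ : nat -> R)
    x rho B :
  0 <= B -> q_ n @[n --> \oo] --> x -> (forall n, rho_ n <= B) ->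
  {ae alpha, forall y,
    \forall n \near \oo, (normsq (y - q_ n) <= rho_ n) = (normsq (y - x) <= rho)} ->
  \int[alpha]_y ball_moment a b (q_ n) (rho_ n) y @[n --> \oo] -->
  \int[alpha]_y ball_moment a b x rho y.
Proof.
move=> B0 qx rB ae.
have m0 q r : measurable_fun setT (EFin \o ball_moment a b q r).
  by apply/measurable_EFinP; exact: measurable_ball_moment.
have [||_ _ h] := @dominated_convergence _ _ _ alpha setT measurableT
  (fun n => EFin \o ball_moment a b (q_ n) (rho_ n))
  (EFin \o ball_moment a b x rho) (cst B%:E) (fun n => m0 _ _) (m0 _ _) _
  (finite_measure_integrable_cst alpha B measurableT) _.
- apply: filterS ae => y e _; apply: cvg_EFin; first exact: nearW.
  exact: (ball_moment_cvg qx e).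
- by apply: aeW => y n _ /=; rewrite lee_fin; exact: ball_moment_bound.
apply: fine_cvg; rewrite fineK ?integrable_fin_num//.
exact: integrable_ball_moment.
Qed.
End moments.

(** * Tensor entries as ball moments, and approximation by rational balls *)

Section empirical.
Context (R : realType) (d : nat).
Implicit Types (x : 'rV[R]_d) (y : nat -> 'rV[R]_d) (sigma : R).

Lemma ge0_integral_empirical n y (f : 'rV[R]_d -> \bar R) :
  measurable_fun setT f -> (forall z, (0 <= f z)%E) ->
  (\int[empirical_measure n y]_z f z = (n%:R^-1)%:E * \sum_(i < n) f (y i))%E.
Proof.
move=> mf f0; rewrite /empirical_measure ge0_integral_mscale//=.
rewrite ge0_integral_measure_sum//; congr (_ * _)%E; apply: eq_bigr => i _.
by rewrite integral_dirac// diracT mul1e.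
Qed.

Lemma Rintegral_empirical n y (f : 'rV[R]_d -> R) : measurable_fun setT f ->
  \int[empirical_measure n y]_z f z = n%:R^-1 * \sum_(i < n) f (y i).
Proof.
move=> mf; have mf' : measurable_fun setT (EFin \o f) by exact/measurable_EFinP.
rewrite /Rintegral integralE !ge0_integral_empirical//; last 2 first.
- exact: measurable_funeneg.
- exact: measurable_funepos.
under eq_bigr => i _ do rewrite funeposE/= -EFin_max.
under [X in (_ - _ * X)%E]eq_bigr => i _ do rewrite funenegE/= -EFin_max.
rewrite !sumEFin -!EFinM -EFinB/= -mulrBr -sumrB; congr (_ * _).
apply: eq_bigr => i _; have [f0|f0] := leP 0 (f (y i)).
  by rewrite (max_idPr _) ?oppr_le0// subr0.
by rewrite (max_idPl _) ?oppr_ge0 ?ltW// sub0r opprK.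
Qed.

Lemma frobenius_sqr (u : 'rV[R]_d) : frobenius u ^+ 2 = normsq u.
Proof.
rewrite /frobenius big_ord1 sqr_sqrtr//.
by apply: sumr_ge0 => j _; exact: sqr_ge0.
Qed.

Definition kernel_cst sigma : R := (sigma ^+ d * unit_ball_volume R d)^-1.

Lemma covariance_integrandE x sigma i j z : 0 < sigma ->
  ((z - x)^T *m (z - x)) i j * truncation_kernel x z sigma =
  kernel_cst sigma * ball_moment i j x (sigma ^+ 2) z.
Proof.
move=> s0; rewrite /truncation_kernel /ball_moment -/(kernel_cst sigma).
rewrite mulrCA; congr (_ * _); rewrite mxE big_ord1 mxE; congr (_ * _).
rewrite indicE frobenius_sqr; congr (_%:R); congr nat_of_bool.
have h : (0 <= normsq (z - x) / sigma ^+ 2 <= 1) = (normsq (z - x) <= sigma ^+ 2).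
  rewrite ler_pdivrMr ?exprn_gt0// mul1r andb_idl// => _.
  by rewrite divr_ge0 ?normsq_ge0 ?sqr_ge0.
by apply/idP/idP; rewrite inE/= in_itv/= h.
Qed.

Lemma covariance_tensorE (alpha : probability 'rV[R]_d R) x sigma i j :
  0 < sigma ->
  covariance_tensor alpha x sigma i j =
  kernel_cst sigma * \int[alpha]_z ball_moment i j x (sigma ^+ 2) z.
Proof.
move=> s0; rewrite mxE; under eq_Rintegral do rewrite covariance_integrandE//.
rewrite RintegralZl//; exact: integrable_ball_moment.
Qed.

Lemma covariance_empiricalE n y x sigma i j :
  0 < sigma ->
  covariance_tensor (empirical_measure n y) x sigma i j =
  kernel_cst sigma *
  (n%:R^-1 * \sum_(k < n) ball_moment i j x (sigma ^+ 2) (y k)).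
Proof.
move=> s0; rewrite mxE; under eq_Rintegral do rewrite covariance_integrandE//.
rewrite Rintegral_empirical.
  by rewrite -mulr_sumr mulrCA.
by apply: measurable_funM => //; exact: measurable_ball_moment.
Qed.

(** Taking the radii slightly too large keeps every point of the closed ball, boundary included,
    inside all approximating balls, while a point outside is eventually excluded. Membership thus
    converges at every point. *)
Lemma rational_balls x sigma : 0 < sigma ->
  exists q_ : nat -> 'rV[rat]_d, exists r_ : nat -> rat,
  [/\ (map_mx ratr (q_ n) : 'rV[R]_d) @[n --> \oo] --> x,
      forall n, ratr (r_ n) <= (2 * sigma) ^+ 2 &
      forall y : 'rV[R]_d, \forall n \near \oo,
        (normsq (y - map_mx ratr (q_ n)) <= ratr (r_ n)) =
        (normsq (y - x) <= sigma ^+ 2)].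
Proof.
(* If each coordinate of the center moves by at most [eps <= 1], the squared distance to a point of
   the ball grows by at most [d * (2 * sigma + 1) * eps = K * eps]. *)
move=> s0; pose K : R := 2 * d%:R * sigma + d%:R.
have K0 : 0 <= K by rewrite addr_ge0// !mulr_ge0// ltW.
(* Ensures [eps n <= 1] and keeps the squared radii below [sigma ^+ 2 + 3 * sigma ^+ 2]. *)
pose eta := Num.min 1 (3 * sigma ^+ 2 / (K + 1)).
have K10 : 0 < K + 1 by rewrite ltr_wpDl.
have eta0 : 0 < eta.
  by rewrite lt_min ltr01 divr_gt0// mulr_gt0// exprn_gt0.
have eta1 : eta <= 1 by rewrite ge_min lexx.
have etaK : (K + 1) * eta <= 3 * sigma ^+ 2.
  by rewrite mulrC -ler_pdivlMr// ge_min lexx orbT.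
pose eps n : R := eta * n.+1%:R^-1.
have eps0 n : 0 < eps n by rewrite mulr_gt0// invr_gt0 ltr0n.
have epseta n : eps n <= eta.
  by rewrite /eps ger_pMr// invf_le1 ?ltr0n// ler1n.
have /choice[q_ qE] : forall n, exists q : 'rV[rat]_d,
    forall j, `|x ord0 j - ratr (q ord0 j)| < eps n.
  move=> n; have /choice[q qP] : forall j, exists q : rat, `|x ord0 j - ratr q| < eps n.
    move=> j; have [|q] := @rat_in_itvoo R (x ord0 j) (x ord0 j + eps n).
      by rewrite ltrDl.
    rewrite in_itv/= => /andP[xq qx]; exists q.
    by rewrite distrC ger0_norm ?subr_ge0 1?ltW// ltrBlDl.
  by exists (\row_j q j) => j; rewrite mxE.
have /choice[r_ rE] : forall n, exists r : rat,
    sigma ^+ 2 + K * eps n < ratr r < sigma ^+ 2 + (K + 1) * eps n.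
  move=> n; have [|r] := @rat_in_itvoo R (sigma ^+ 2 + K * eps n) (sigma ^+ 2 + (K + 1) * eps n).
    by rewrite ltrD2l ltr_pM2r// ltrDl.
  by rewrite in_itv/= => h; exists r.
have eps_cvg : eps n @[n --> \oo] --> 0.
  rewrite -(mulr0 eta); apply: cvgM; first exact: cvg_cst.
  exact: cvg_harmonic.
have qx : (map_mx ratr (q_ n) : 'rV[R]_d) @[n --> \oo] --> x.
  apply/cvg_ballP => e e0.
  have : \forall n \near \oo, eps n < e by exact: cvgr_lt eps_cvg _ e0.
  apply: filterS => n epse; split=> // i j; rewrite ord1 mxE /ball/=.
  exact: lt_trans (qE n j) epse.
have rs : (ratr (r_ n) : R) @[n --> \oo] --> sigma ^+ 2.
  apply: (@squeeze_cvgr _ _ _ _ (fun n => sigma ^+ 2 + K * eps n)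
      (fun n => sigma ^+ 2 + (K + 1) * eps n)).
  - by apply: nearW => n; have /andP[/ltW -> /ltW ->] := rE n.
  - have e : sigma ^+ 2 = sigma ^+ 2 + K * 0 by rewrite mulr0 addr0.
    rewrite [X in _ --> X]e.
    by apply: cvgD; [exact: cvg_cst|apply: cvgM => //; exact: cvg_cst].
  - have e : sigma ^+ 2 = sigma ^+ 2 + (K + 1) * 0 by rewrite mulr0 addr0.
    rewrite [X in _ --> X]e.
    by apply: cvgD; [exact: cvg_cst|apply: cvgM => //; exact: cvg_cst].
exists q_, r_; split => // [n|y].
  have /andP[_ /ltW] := rE n => /le_trans; apply.
  have : (K + 1) * eps n <= (K + 1) * eta by rewrite ler_pM2l.
  by rewrite exprMn; lra.
have [yx|yx] := leP (normsq (y - x)) (sigma ^+ 2).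
  apply: nearW => n; have /andP[/ltW h _] := rE n; apply: (le_trans _ h).
  pose v j := x ord0 j - ratr (q_ n ord0 j).
  have -> : normsq (y - map_mx ratr (q_ n)) =
      normsq (y - x) + \sum_j (2 * (y - x) ord0 j * v j + v j ^+ 2).
    rewrite /normsq -big_split/=; apply: eq_bigr => j _; rewrite /v !mxE; ring.
  rewrite lerD//; have -> : K * eps n = \sum_(j < d) (2 * sigma + 1) * eps n.
    by rewrite sumr_const card_ord -[RHS]mulr_natl /K; ring.
  apply: ler_sum => j _; have hj := coord_le_of_normsq j (ltW s0) yx.
  have vj : `|v j| <= eps n by exact/ltW/qE.
  have e1 : eps n <= 1 by exact: le_trans (epseta n) eta1.
  have h1 : (y - x) ord0 j * v j <= sigma * eps n.
    by rewrite (le_trans (ler_norm _))// normrM ler_pM.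
  have h2 : v j ^+ 2 <= eps n * 1.
    by rewrite -(real_normK (num_real (v j))) expr2 ler_pM// (le_trans vj).
  by rewrite -mulrA; lra.
have h : normsq (y - map_mx ratr (q_ n)) @[n --> \oo] --> normsq (y - x).
  exact: normsqB_cvg.
rewrite -subr_gt0 in yx.
apply: filterS (cvgr_gt _ (cvgB h rs) _ yx) => n.
by rewrite /= subr_gt0 => /lt_geF.
Qed.

Lemma ball_deviation_dense (alpha : probability 'rV[R]_d R) n y a b sigma t :
  0 < sigma ->
  (forall (q : 'rV[rat]_d) (r : rat), ratr r <= (2 * sigma) ^+ 2 ->
    `|n%:R^-1 * (\sum_(k < n) ball_moment a b (map_mx ratr q) (ratr r) (y k)) -
      \int[alpha]_z ball_moment a b (map_mx ratr q) (ratr r) z| <= t) ->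
  forall x,
    `|n%:R^-1 * (\sum_(k < n) ball_moment a b x (sigma ^+ 2) (y k)) -
      \int[alpha]_z ball_moment a b x (sigma ^+ 2) z| <= t.
Proof.
move=> s0 ht x; have [q_ [r_ [qx rs qr]]] := rational_balls x s0.
have c1 : (n%:R^-1 * (\sum_(k < n) ball_moment a b (map_mx ratr (q_ m)) (ratr (r_ m)) (y k)) -
      \int[alpha]_z ball_moment a b (map_mx ratr (q_ m)) (ratr (r_ m)) z) @[m --> \oo] -->
    n%:R^-1 * (\sum_(k < n) ball_moment a b x (sigma ^+ 2) (y k)) -
      \int[alpha]_z ball_moment a b x (sigma ^+ 2) z.
  apply: cvgB.
    apply: cvgM; first exact: cvg_cst.
    by apply: cvg_sumR => k; exact: ball_moment_cvg.
  apply: (@Rintegral_ball_moment_cvg _ _ _ _ _ _ _ _ _ ((2 * sigma) ^+ 2)) => //.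
    exact: sqr_ge0.
  by apply: aeW.
rewrite -(cvg_lim _ (cvg_norm c1))//.
apply: limr_le; first by apply/cvg_ex; eexists; exact: (cvg_norm c1).
by apply: nearW => m; exact: ht.
Qed.

End empirical.

(** * Measurability of the supremum *)

Lemma measurable_sphere (R : realType) (d : nat) (x : 'rV[R]_d) (s : R) :
  measurable [set y | normsq (y - x) = s].
Proof.
rewrite (_ : mkset _ = ~` [set y | normsq (y - x) < s] `&` ~` [set y | s < normsq (y - x)]).
  by apply: measurableI; apply: measurableC; apply: measurable_lt_set => //;
    exact: measurable_normsqB.
apply/seteqP; split=> [y /= ->|y [/= /negP + /negP]]; first by rewrite ltxx.
by rewrite -!leNgt => h1 h2; apply/eqP; rewrite eq_le h1 h2.
Qed.

(** By Fubini: once all coordinates but the first are fixed, at most two values of the first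
    remain. *)
Lemma lebesgue_rV_sphere (R : realType) (d : nat) (x : 'rV[R]_d.+1) (s : R) :
  lebesgue_rV R d.+1 [set y | normsq (y - x) = s] = 0%E.
Proof.
pose S := [set y : 'rV[R]_d.+1 | normsq (y - x) = s].
have mS : measurable S by exact: measurable_sphere.
set A := @cons_rV R d @^-1` S.
have mA : measurable A.
  by rewrite -[X in measurable X]setTI; exact: measurable_cons_rV.
transitivity ((@lebesgue_measure R \x lebesgue_rV R d)%E A); first by [].
transitivity ((@lebesgue_measure R \x^ lebesgue_rV R d)%E A).
  by apply: product_measure_unique => // B C mB mC; exact: product_measure2E.
rewrite /product_measure2; apply: integral0_eq => v _ /=.
pose c := \sum_(j < d) (v ord0 j - x ord0 (lift ord0 j)) ^+ 2.
(* For [s < c] the root is 0 by convention; the slice is then empty and the inclusion still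
   holds. *)
pose r := Num.sqrt (s - c).
apply/eqP; rewrite -measure_le0 -(countable_lebesgue_measure0 (A := [set x ord0 ord0 + r; x ord0 ord0 - r])); last first.
  exact: finite_set_countable.
apply: le_measure; rewrite ?inE//.
- exact: measurable_ysection.
- by apply: measurableU; exact: measurable_set1.
move=> u /ysectionP; rewrite /A /S /=.
have subE (y : 'rV[R]_d.+1) j : (y - x) ord0 j = y ord0 j - x ord0 j by rewrite !mxE.
rewrite /normsq big_ord_recl subE cons_rV0 [X in _ + X](_ : _ = c) => [/= e|]; last first.
  by apply: eq_bigr => j _; rewrite subE cons_rVS.
have e' : (u - x ord0 ord0) ^+ 2 = s - c by rewrite -e addrK.
have : `|u - x ord0 ord0| = r by rewrite /r -e' sqrtr_sqr.
move=> rE; have [h|h] := leP 0 (u - x ord0 ord0); [left|right]; rewrite /= -rE.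
  by rewrite ger0_norm// addrC subrK.
by rewrite ltr0_norm// opprK addrC subrK.
Qed.

(** Brings continuity down to sequences, the form in which dominated convergence applies. *)
Lemma cvg_at_of_seq (R : realType) (d : nat) (f : 'rV[R]_d -> R) x :
  (forall u : nat -> 'rV[R]_d, u n @[n --> \oo] --> x -> f (u n) @[n --> \oo] --> f x) ->
  f y @[y --> x] --> f x.
Proof.
move=> h; apply/(@cvgrPdist_lt _ _ _ _ (nbhs_filter x)) => e e0; apply: contrapT => nh.
have /choice[u uP] : forall n : nat, exists y, ball x n.+1%:R^-1 y /\ ~ `|f x - f y| < e.
  move=> n; apply: contrapT => /forallNP hn; apply: nh.
  apply/nbhs_ballP; exists n.+1%:R^-1; first by rewrite /= invr_gt0 ltr0n.
  by move=> y yx; apply: contrapT => yn; apply: (hn y).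
have ux : u n @[n --> \oo] --> x.
  apply/cvg_ballP => r r0; apply: filterS (near_infty_natSinv_lt (PosNum r0)) => n /= nr.
  exact: le_ball (ltW nr) _ (uP n).1.
have /cvgrPdist_lt/(_ _ e0)[N _ /(_ N (leqnn N))] := h _ ux.
exact: (uP N).2.
Qed.

Lemma Rintegral_ball_moment_continuous (R : realType) (d : nat)
    (alpha : probability 'rV[R]_d R) a b (rho : R) x :
  (forall x, alpha [set y | normsq (y - x) = rho] = 0%E) ->
  (\int[alpha]_z ball_moment a b y rho z) @[y --> x] -->
  (\int[alpha]_z ball_moment a b x rho z).
Proof.
move=> a0; apply: cvg_at_of_seq => u ux.
apply: (@Rintegral_ball_moment_cvg _ _ _ _ _ _ (fun=> rho) _ _ `|rho|) => //.
  by move=> _; exact: ler_norm.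
exists [set y | normsq (y - x) = rho]; split => //; first exact: measurable_sphere.
move=> y /= ny; apply: contrapT => ne; apply: ny.
have h : normsq (y - u n) @[n --> \oo] --> normsq (y - x) by exact: normsqB_cvg.
have [lt|gt|eq] := ltgtP (normsq (y - x)) rho; last by rewrite eq in ne.
  by apply: filterS (cvgr_le _ h _ lt) => n ->.
by apply: filterS (cvgr_gt _ h _ gt) => n /lt_geF ->.
Qed.

(** The uncountable projection becomes a countable condition: for each [m], some rational point has
    value below [1 / (m + 1)]. Coercivity makes the infimum attained, so these conditions force a
    nonpositive value. *)
Lemma measurable_exists_le0 (R : realType) (d : nat) d' (T : measurableType d')
    (h : T -> 'rV[R]_d -> R) (K : R) :
  (forall w, continuous (h w)) ->
  (forall x, measurable_fun setT (h ^~ x)) ->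
  (forall w x, `|x| - K <= h w x) ->
  measurable [set w | exists x, h w x <= 0].
Proof.
move=> ch mh coer.
rewrite (_ : mkset _ = \bigcap_(m : nat) \bigcup_(q : 'rV[rat]_d)
   [set w | h w (map_mx ratr q) < m.+1%:R^-1]).
  apply: bigcapT_measurable => m; apply: countable_bigcupT_measurable => // q.
  by apply: measurable_lt_set => //; exact: mh.
apply/seteqP; split=> [w [x hx] m _|w hw].
  have oU : open [set x | h w x < m.+1%:R^-1].
    by apply: (@open_comp _ _ (h w) [set r | r < m.+1%:R^-1]) => [y _|];
      [exact: ch|exact: open_lt].
  have : [set x | h w x < m.+1%:R^-1] x.
    by rewrite /= (le_lt_trans hx)// invr_gt0 ltr0n.
  rewrite (open_rV_bigcup oU) => -[[q k] /= qU _]; exists q => //.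
  by apply: qU; apply: ballxx; rewrite invr_gt0 ltr0n.
(* A compact set containing every point where [h w] is below 1. *)
pose B : set 'rV[R]_d := [set x | `|x| <= K + 1].
have qB q : h w q < 1 -> B q.
  by move=> h1; have := coer w q; rewrite /B/=; lra.
have cB : compact B.
  apply: bounded_closed_compact.
    by exists (K + 1); split; [exact: num_real|move=> M KM x /= /le_trans; apply; exact: ltW].
  apply: (@closed_comp _ _ (fun x : 'rV[R]_d => `|x|) [set r | r <= K + 1]).
    by move=> x _; exact: norm_continuous.
  exact: closed_le.
have [q0 _ q0h] := hw 0%N I.
have B0 : B !=set0.
  by exists (map_mx ratr q0); apply: qB; rewrite (lt_le_trans q0h)// invr1.
have [c _ cmin] := EVT_min_rV B0 cB (continuous_subspaceT (ch w)).
exists c; rewrite leNgt; apply/negP => c0.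
have [m _ mP] := near_infty_natSinv_lt (PosNum c0).
have [q _ qh] := hw m I.
have mc : m.+1%:R^-1 < h w c := mP m (leqnn m).
have qc := lt_trans qh mc.
have qB' : B (map_mx ratr q).
  apply: qB; apply: (lt_le_trans qh); rewrite invf_le1 ?ltr0n//.
  by rewrite ler1n.
by have := cmin _ (mem_set qB'); rewrite leNgt qc.
Qed.

Section exists_large_deviation.
Context (R : realType) (d n : nat) (d' : measure_display) (T : measurableType d')
  (Y : 'I_n -> T -> 'rV[R]_d) (phi : 'I_d -> 'I_d -> 'rV[R]_d -> R) (c s r : R).
Hypotheses (mY : forall i, measurable_fun setT (Y i))
  (cphi : forall a b, continuous (phi a b)).

(** Twice the positive part: a continuous penalty that vanishes exactly when [z <= 0]. *)
Let pos (z : R) := z + `|z|.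

Let pos_ge0 z : 0 <= pos z.
Proof. by rewrite /pos addrC -lerBlDr sub0r -normrN ler_norm. Qed.

Let pos_eq0 z : (pos z == 0) = (z <= 0).
Proof.
rewrite /pos; have [z0|z0] := leP z 0; first by rewrite ler0_norm// subrr eqxx.
by rewrite gtr0_norm// gt_eqF// addr_gt0.
Qed.

Let pos_cvg (U : Type) (F : set_system U) (FF : Filter F) (f : U -> R) l :
  f x @[x --> F] --> l -> pos (f x) @[x --> F] --> pos l.
Proof. by move=> fl; apply: cvgD => //; exact: cvg_norm. Qed.

Let measurable_pos (f : T -> R) :
  measurable_fun setT f -> measurable_fun setT (fun w => pos (f w)).
Proof. by move=> mf; apply: measurable_funD => //; exact: measurableT_comp. Qed.

Let D (e : {ffun 'I_n -> bool}) a b w x : R :=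
  c * (n%:R^-1 * \sum_i (e i)%:R * ((Y i w - x) ord0 a * (Y i w - x) ord0 b)) -
  phi a b x.

(** Nonpositive when the position of the [i]-th point relative to the ball is as [e] prescribes.
    Being outside is an open condition, so it is exhausted by closed ones with margin
    [1 / (k + 1)]. *)
Let cell (e : {ffun 'I_n -> bool}) (k : nat) i w x : R :=
  if e i then normsq (Y i w - x) - s else s + k.+1%:R^-1 - normsq (Y i w - x).

(** A sum of penalties, so that a conjunction of closed conditions reads [h <= 0]. The last penalty
    confines [x] to a bounded set and supplies coercivity. *)
Let h e k w x : R :=
  \sum_i pos (cell e k i w x) +
  pos (r + k.+1%:R^-1 - \sum_a \sum_b D e a b w x ^+ 2) + pos (`|x| - k%:R).

Let continuous_h e k w : continuous (h e k w).
Proof.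
move=> x; have FF := nbhs_filter x; rewrite /h; apply: (@cvgD _ _ _ _ FF); [apply: (@cvgD _ _ _ _ FF)|].
- apply: cvg_sumR => i; apply: pos_cvg; rewrite /cell; case: (e i).
    by apply: cvgB; [exact: normsqB_cvg|exact: cvg_cst].
  by apply: cvgB; [exact: cvg_cst|exact: normsqB_cvg].
- apply: pos_cvg; apply: cvgB; first exact: cvg_cst.
  apply: cvg_sumR => a; apply: cvg_sumR => b.
  have cD : D e a b w y @[y --> x] --> D e a b w x.
    apply: cvgB; last exact: cphi.
    apply: cvgM; first exact: cvg_cst.
    apply: cvgM; first exact: cvg_cst.
    apply: cvg_sumR => i; apply: cvgM; first exact: cvg_cst.
    by apply: cvgM; exact: coordB_cvg.
  by rewrite expr2; under eq_fun do rewrite expr2; exact: cvgM.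
- apply: pos_cvg; apply: cvgB; last exact: cvg_cst.
  exact: norm_continuous.
Qed.

Let measurable_coordY i a x : measurable_fun setT (fun w => (Y i w - x) ord0 a).
Proof. exact: (measurableT_comp (measurable_coordB x a) (mY i)). Qed.

Let measurable_normsqY i x : measurable_fun setT (fun w => normsq (Y i w - x)).
Proof. exact: (measurableT_comp (measurable_normsqB x) (mY i)). Qed.

Let measurable_h e k x : measurable_fun setT (fun w => h e k w x).
Proof.
apply: measurable_funD; last exact: measurable_cst.
apply: measurable_funD.
  apply: measurable_fun_sumR => i; apply: measurable_pos; rewrite /cell.
  by case: (e i); apply: measurable_funB.
apply: measurable_pos; apply: measurable_funB => //.
apply: measurable_fun_sumR => a; apply: measurable_fun_sumR => b.
apply: measurable_funX; apply: measurable_funB => //.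
apply: measurable_funM => //; apply: measurable_funM => //.
apply: measurable_fun_sumR => i; apply: measurable_funM => //.
exact: measurable_funM.
Qed.

Let h_le0 e k w x : h e k w x <= 0 <->
  [/\ forall i, cell e k i w x <= 0,
      r + k.+1%:R^-1 <= \sum_a \sum_b D e a b w x ^+ 2 & `|x| <= k%:R].
Proof.
have S0 : 0 <= \sum_i pos (cell e k i w x) by apply: sumr_ge0.
split=> [h0|[h1 h2 h3]].
  have h00 : 0 <= h e k w x by apply: addr_ge0 => //; apply: addr_ge0.
  have : h e k w x == 0 by rewrite eq_le h0 h00.
  rewrite /h paddr_eq0; [|exact: addr_ge0|by []].
  rewrite paddr_eq0// psumr_eq0//.
  rewrite !pos_eq0 !subr_le0 => /andP[/andP[/allP hi ->] ->]; split=> // i.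
  by rewrite -pos_eq0; apply: hi; rewrite mem_index_enum.
have p0 z : z <= 0 -> pos z = 0 by rewrite -pos_eq0 => /eqP.
by rewrite /h big1 => [|i _]; rewrite ?p0 ?subr_le0 ?addr0.
Qed.

Lemma measurable_exists_large_deviation :
  measurable [set w | exists x, r < \sum_a \sum_b
    (c * (n%:R^-1 * \sum_i ball_moment a b x s (Y i w)) - phi a b x) ^+ 2].
Proof.
rewrite (_ : mkset _ = \bigcup_(e in [set: {ffun 'I_n -> bool}]) \bigcup_k
    [set w | exists x, h e k w x <= 0]).
  apply: fin_bigcup_measurable => // e _; apply: bigcupT_measurable => k.
  apply: (@measurable_exists_le0 _ _ _ _ (h e k) k%:R) => // w x.
  rewrite /h -[leLHS]add0r; apply: lerD; last by rewrite /pos lerDl.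
  by apply: addr_ge0 => //; exact: sumr_ge0.
have DE (e : {ffun 'I_n -> bool}) w x : (forall i, e i = (normsq (Y i w - x) <= s)) ->
    \sum_a \sum_b D e a b w x ^+ 2 = \sum_a \sum_b
      (c * (n%:R^-1 * \sum_i ball_moment a b x s (Y i w)) - phi a b x) ^+ 2.
  move=> eE; apply: eq_bigr => a _; apply: eq_bigr => b _.
  congr ((c * (_ * _) - _) ^+ 2); apply: eq_bigr => i _.
  by rewrite /ball_moment eE mulrC.
apply/seteqP; split=> [w [x rx]|w [e _ [k _ [x /h_le0[h1 h2 h3]]]]]; last first.
  exists x; rewrite -(DE e).
    by rewrite (lt_le_trans _ h2)// ltrDl invr_gt0 ltr0n.
  move=> i; have := h1 i; rewrite /cell; case: (e i) => /=; rewrite subr_le0 => hi; first by rewrite hi.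
  apply/esym/negbTE; rewrite -ltNge (lt_le_trans _ hi)// ltrDl.
  by rewrite invr_gt0 ltr0n.
pose e := [ffun i => normsq (Y i w - x) <= s].
have eE i : e i = (normsq (Y i w - x) <= s) by rewrite ffunE.
have : \forall k \near \oo, h e k w x <= 0.
  have gap (u v : R) : u < v -> \forall k \near \oo, u + k.+1%:R^-1 <= v.
    rewrite -subr_gt0 => uv.
    apply: filterS (near_infty_natSinv_lt (PosNum uv)) => k /= /ltW.
    by rewrite lerBrDl.
  have near1 : \forall k \near \oo, forall i, cell e k i w x <= 0.
    apply: filter_forall => i; rewrite /cell eE.
    have [hi|hi] := leP (normsq (Y i w - x)) s.
      by apply: nearW => k; rewrite subr_le0.
    by apply: filterS (gap _ _ hi) => k; rewrite subr_le0.
  have near2 := gap _ _ rx.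
  have near3 : \forall k \near \oo, `|x| <= k%:R by exact: nbhs_infty_ger.
  apply: filterS3 near1 near2 near3 => k k1 k2 k3; apply/h_le0; split=> //.
  by rewrite DE.
by case=> N _ /(_ N (leqnn N)) hN; exists e => //; exists N => //; exists x.
Qed.

End exists_large_deviation.

(** * The deviation bound *)

Lemma ln2_ge_half (R : realType) : 2^-1 <= ln 2 :> R.
Proof.
rewrite -ler_expR lnK ?posrE//.
have e1 := expR_ge1Dx (- 2^-1 : R).
have e2 : expR (2^-1 : R) * expR (- 2^-1) = 1 by rewrite -expRD subrr expR0.
have e3 := expR_gt0 (2^-1 : R).
by nra.
Qed.

Lemma ln_nat_ge_half (R : realType) (n : nat) : (2 <= n)%N -> 2^-1 <= ln n%:R :> R.
Proof.
move=> n2; apply: (le_trans (ln2_ge_half R)).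
by rewrite ler_ln ?posrE ?ltr0n ?ler_nat// (leq_trans _ n2).
Qed.

(** For [d = 2] the rate has the extra factor [ln n ^ (1 / 4)], and the constant 2 covers [n = 2],
    where [ln n < 1]. For [d >= 3], [ln n / n <= 1] makes the power [1 / d] at least the square
    root. *)
Lemma rate_lower_bound (R : realType) (d n : nat) : (2 <= d)%N -> (2 <= n)%N ->
  Num.sqrt (ln n%:R / n%:R) <= 2 * rate R d n.
Proof.
move=> d2 n2; rewrite /rate.
have l2 := ln_nat_ge_half R n2; set l : R := ln n%:R in l2 *.
have l0 : 0 < l by apply: lt_le_trans l2; rewrite invr_gt0.
have n0 : 0 < n%:R :> R by rewrite ltr0n (leq_trans _ n2).
have divE s : l `^ s / n%:R `^ s = (l / n%:R) `^ s.
  by rewrite -powRN -(mulN1r s) powRrM powR_inv1 ?ltW// -powRM ?invr_ge0 ?ltW.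
have u0 : 0 < l / n%:R by rewrite divr_gt0.
rewrite -(powR12_sqrt (ltW u0)).
have [_|d3] := eqVneq d 2%N.
  have -> : 3 / 4 = 2^-1 + 4^-1 :> R by field.
  rewrite powRD; last by rewrite gt_eqF ?implybT// addr_gt0.
  rewrite div1r mulrAC divE mulrCA -[leLHS]mulr1 ler_wpM2l ?powR_ge0//.
  have [l1|l1] := leP 1 l.
    have : l `^ 0 <= l `^ 4^-1 by rewrite ler_powR.
    by rewrite powRr0; lra.
  have : l <= l `^ 4^-1.
    by apply: ger1_powR; [rewrite l0 ltW|lra].
  by lra.
rewrite divE.
have u1 : l / n%:R <= 1.
  rewrite ler_pdivrMr// mul1r.
  have e : 1 + (n%:R - 1) = n%:R :> R by ring.
  have : ln (1 + (n%:R - 1)) <= n%:R - 1 :> R by apply: le_ln1Dx; lra.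
  by rewrite e -/l; lra.
have h : (l / n%:R) `^ 2^-1 <= (l / n%:R) `^ d%:R^-1.
  apply: ger_powR; first by rewrite u0 u1.
  by rewrite lef_pV2 ?posrE ?ltr0n ?(leq_trans _ d2)// ler_nat.
have := powR_ge0 (l / n%:R) d%:R^-1; lra.
Qed.

Section deviation.
Context (R : realType) (d : nat) (d' : measure_display) (T : measurableType d')
  (P : probability T R) (alpha : probability 'rV[R]_d R)
  (y : nat -> {RV P >-> 'rV[R]_d}) (n : nat) (L tau : R).
Hypotheses (iidy : iid y alpha) (n0 : (0 < n)%N) (L0 : 0 < L) (tau0 : 0 < tau)
  (ntau : 1 <= n%:R * tau ^+ 2).

Let code (k : nat) : 'rV[rat]_d * rat := odflt (0, 0) (unpickle k).

(** The cap makes the whole enumeration bounded by [L ^+ 2] and leaves the balls with squared radius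
    at most [L ^+ 2] unchanged. *)
Let g a b k : 'rV[R]_d -> R :=
  ball_moment a b (map_mx ratr (code k).1) (Num.min (ratr (code k).2) (L ^+ 2)).

Let dev a b k w : R :=
  \sum_(i < n) g a b k (y i w) - n%:R * \int[alpha]_z g a b k z.

Let delta : R := (n.*2.+1 ^ d.+2)%:R * (8 * expR (- (n%:R * tau ^+ 2 / 8))).

Lemma ball_deviation_probability a b :
  (P [set w | exists k, (n%:R * (36 * L ^+ 2 * tau) < `|dev a b k w|)%R] <=
   (2 * delta)%:E)%E.
Proof.
have L20 : 0 < L ^+ 2 by rewrite exprn_gt0.
(* The constant 36 is twice the 18 of [card_large_signed_sum], since symmetrization halves the
   threshold. *)
apply: (@symmetrization _ _ _ _ _ _ _ _ _ (g a b) (L ^+ 2)) => //.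
- by move=> k; exact: measurable_ball_moment.
- by move=> k x; apply: ball_moment_bound; [exact: ltW|rewrite ge_min lexx orbT].
- by rewrite !mulr_gt0.
- have a0 := exprn_gt0 2 L20.
  have -> : n%:R * (36 * L ^+ 2 * tau) ^+ 2 = 1296 * ((L ^+ 2) ^+ 2 * (n%:R * tau ^+ 2)) by ring.
  have : (L ^+ 2) ^+ 2 * 1 <= (L ^+ 2) ^+ 2 * (n%:R * tau ^+ 2) by rewrite ler_pM2l.
  by lra.
move=> z.
have -> : 2 ^+ n * delta = (n.*2.+1 ^ d.+2)%:R *
    (8 * 2 ^+ n * expR (- (n%:R * tau ^+ 2 / 8))) by rewrite /delta; ring.
apply: (le_trans _ (card_large_signed_sum a b z (ltW L0) (ltW tau0))).
rewrite ler_nat; apply: subset_leq_card; apply/fintype.subsetP => e.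
rewrite inE => /asboolP[k hk]; rewrite inE; apply/asboolP.
exists (map_mx ratr (code k).1), (Num.min (ratr (code k).2) (L ^+ 2)).
split; first by rewrite ge_min lexx orbT.
by apply: le_lt_trans hk; rewrite le_eqVlt; apply/orP; left; apply/eqP; field.
Qed.

Lemma ball_deviation_of_dev a b w :
  (forall k, `|dev a b k w| <= n%:R * (36 * L ^+ 2 * tau)) ->
  forall (q : 'rV[rat]_d) (r : rat), ratr r <= L ^+ 2 ->
  `|n%:R^-1 * (\sum_(k < n) ball_moment a b (map_mx ratr q) (ratr r) (y k w)) -
    \int[alpha]_z ball_moment a b (map_mx ratr q) (ratr r) z| <=
  36 * L ^+ 2 * tau.
Proof.
move=> hw q r rL; have := hw (pickle (q, r)).
have n0' : 0 < n%:R :> R by rewrite ltr0n.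
rewrite /dev /g /code pickleK/= (min_idPl rL) => h.
rewrite -(ler_pM2l n0'); apply: le_trans h.
rewrite -{1}(gtr0_norm n0') -normrM mulrBr mulrA divff ?gt_eqF// mul1r.
by [].
Qed.

Lemma measurable_dev a b :
  measurable [set w | exists k, n%:R * (36 * L ^+ 2 * tau) < `|dev a b k w|].
Proof.
apply: measurable_existsP => k; apply: measurable_lt_norm_set.
apply: measurable_funB => //; apply: measurable_fun_sumR => i.
by apply: measurableT_comp => //; exact: measurable_ball_moment.
Qed.

End deviation.

(** * From single moments to the tensor field: union bound, null spheres, final constants *)

Lemma measure_bigsetU_le (R : realType) d (T : measurableType d)
    (mu : {measure set T -> \bar R}) (I : Type) (s : seq I) (A : I -> set T) :
  (forall i, measurable (A i)) ->
  (mu (\big[setU/set0]_(i <- s) A i) <= \sum_(i <- s) mu (A i))%E.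
Proof.
move=> mA; elim: s => [|i s IH]; first by rewrite !big_nil measure0.
rewrite !big_cons; apply: (le_trans (measureU2 _ _ _)) => //.
  exact: bigsetU_measurable.
exact: leeD.
Qed.

Lemma density_sphere (R : realType) (d : nat) (f : 'rV[R]_d -> R)
    (alpha : {measure set 'rV[R]_d -> \bar R}) (x : 'rV[R]_d) (s : R) :
  (0 < d)%N -> is_density f alpha -> alpha [set y | normsq (y - x) = s] = 0%E.
Proof.
case: d f alpha x => // d f alpha x _ [mf _ fE].
rewrite fE; last exact: measurable_sphere.
apply: null_set_integral; first exact: measurable_sphere.
  by apply/measurable_EFinP; exact: measurable_funTS.
exact: lebesgue_rV_sphere.
Qed.

Lemma frobenius_le (R : realType) (m n : nat) (A : 'M[R]_(m, n)) (r : R) :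
  0 <= r -> (frobenius A <= r) = (\sum_i \sum_j A i j ^+ 2 <= r ^+ 2).
Proof.
move=> r0; have S0 : 0 <= \sum_i \sum_j A i j ^+ 2.
  by apply: sumr_ge0 => i _; apply: sumr_ge0 => j _; exact: sqr_ge0.
by rewrite -(ler_pXn2r (ltn0Sn 1)) ?nnegrE ?sqrtr_ge0// sqr_sqrtr.
Qed.

Lemma rate_ge0 (R : realType) (d n : nat) : 0 <= rate R d n.
Proof. by rewrite /rate; case: ifP => _; rewrite divr_ge0// powR_ge0. Qed.

(** The summand [d.+2] in the exponent absorbs the number of traces, as [2 * n + 1 <= 3 * n]. *)
Lemma tail_bound (R : realType) (d n : nat) (p : R) : (2 <= n)%N ->
  (n.*2.+1 ^ d.+2)%:R * (8 * expR (- ((p + d.+2%:R) * ln n%:R))) <=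
  8 * 3 ^+ d.+2 * n%:R `^ (- p).
Proof.
move=> n2; have n0 : 0 < n%:R :> R by rewrite ltr0n (leq_trans _ n2).
have -> : expR (- ((p + d.+2%:R) * ln n%:R)) = n%:R `^ (- p) / n%:R ^+ d.+2.
  rewrite mulrDl opprD expRD; congr (_ * _).
    by rewrite /powR gt_eqF// mulNr.
  by rewrite expRN expRM_natl lnK.
have h : (n.*2.+1 ^ d.+2)%:R <= 3 ^+ d.+2 * n%:R ^+ d.+2 :> R.
  rewrite -exprMn natrX lerXn2r ?nnegrE ?mulr_ge0//.
  rewrite -natrM ler_nat -addnn -addn1 mulSn mulSn mul1n.
  by rewrite -addnA leq_add2l leq_add2l (leq_trans _ n2).
have P0 := powR_ge0 (n%:R : R) (- p).
have h' : (n.*2.+1 ^ d.+2)%:R / n%:R ^+ d.+2 <= 3 ^+ d.+2 :> R.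
  by rewrite ler_pdivrMr// exprn_gt0.
have -> : (n.*2.+1 ^ d.+2)%:R * (8 * (n%:R `^ (- p) / n%:R ^+ d.+2)) =
    8 * n%:R `^ (- p) * ((n.*2.+1 ^ d.+2)%:R / n%:R ^+ d.+2) :> R by ring.
by rewrite [leRHS]mulrAC ler_wpM2l// mulr_ge0.
Qed.

Local Open Scope ring_scope.

Theorem corollary3 (R : realType) (d : nat) (Omega : set 'rV[R]_d) (lambda : R) :
  (2 <= d)%N ->
  bounded_set Omega -> connected Omega -> lipschitz_boundary Omega ->
  1 <= lambda ->
  exists2 c1 : R, 0 < c1 &
  forall sigma p : R, 0 < sigma -> 1 < p ->
  exists2 C : R, 0 < C &
  forall (alpha : probability 'rV[R]_d R) (f : 'rV[R]_d -> R),
    is_density f alpha ->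
    Omega = (msupport alpha)° ->
    (forall z, Omega z -> lambda^-1 <= f z <= lambda) ->
  forall (disp : measure_display) (T : measurableType disp)
    (P : probability T R) (y : nat -> {RV P >-> 'rV[R]_d}),
    iid y alpha ->
  forall n : nat, (1 <= n)%N ->
  let E := [set w : T |
    (ereal_sup [set (frobenius
        (covariance_tensor (empirical_measure n (fun i => y i w)) x sigma -
         covariance_tensor alpha x sigma))%:E | x in [set: 'rV[R]_d]]
     <= (C * rate R d n)%:E)%E] in
  measurable E /\ ((1 - c1 * n%:R `^ (- p))%:E <= P E)%E.
Proof.
move=> d2 _ _ _ _.
have d0 : 0 < d%:R :> R by rewrite ltr0n (leq_trans _ d2).
(* The number of entries, times the factor 2 of symmetrization, times the constant of
   [tail_bound]. *)
pose D : R := d%:R ^+ 2 * (2 * (8 * 3 ^+ d.+2)).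
have D1 : 1 <= D.
  rewrite -[1]mulr1 ler_pM// ?exprn_ege1 ?ler1n ?(leq_trans _ d2)//.
  have : 1 <= 3 ^+ d.+2 :> R by rewrite exprn_ege1// ler1n.
  by lra.
exists D; first exact: lt_le_trans ltr01 D1.
move=> sigma p s0 p1.
(* Chosen so that [n * tau ^ 2 / 8] equals the exponent [(p + d.+2) * ln n] of [tail_bound]. *)
pose kappa : R := 8 * (p + d.+2%:R).
have kappa8 : 8 <= kappa.
  by rewrite /kappa ler_peMr//; have : 0 <= d.+2%:R :> R by []; lra.
(* The rational balls approximating a ball of radius [sigma] have squared radius up to
   [(2 * sigma) ^+ 2]. *)
pose L := 2 * sigma; have L0 : 0 < L by rewrite mulr_gt0.
pose c := kernel_cst d sigma.
pose C1 := d%:R * (`|c| * (36 * L ^+ 2 * (Num.sqrt kappa * 2))).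
have C10 : 0 <= C1.
  by rewrite !mulr_ge0 ?sqr_ge0 ?sqrtr_ge0// ltW.
(* Adding 1 to the nonnegative [C1] gives a positive constant. *)
exists (C1 + 1); first by rewrite ltr_wpDl.
move=> alpha f df _ _ disp T P y iidy n n1 E.
have a0 x s : alpha [set z | normsq (z - x) = s] = 0%E.
  by apply: (density_sphere _ _ _ df); rewrite (leq_trans _ d2).
pose r := (C1 + 1) * rate R d n.
have r0 : 0 <= r by rewrite mulr_ge0 ?addr_ge0 ?rate_ge0.
pose phi a b x := c * \int[alpha]_z ball_moment a b x (sigma ^+ 2) z.
have cphi a b : continuous (phi a b).
  move=> x; have FF := nbhs_filter x; apply: (@cvgM _ _ _ FF); first exact: cvg_cst.
  exact: Rintegral_ball_moment_continuous.
pose B := [set w : T | exists x, r ^+ 2 < \sum_a \sum_b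
  (c * (n%:R^-1 * \sum_(i < n) ball_moment a b x (sigma ^+ 2) (y i w)) - phi a b x) ^+ 2].
have mB : measurable B.
  by apply: (@measurable_exists_large_deviation _ _ _ _ _ (fun i => y i)) => // i.
have frobE w x : (frobenius
    (covariance_tensor (empirical_measure n (fun i => y i w)) x sigma -
     covariance_tensor alpha x sigma) <= r) = (\sum_a \sum_b
  (c * (n%:R^-1 * \sum_(i < n) ball_moment a b x (sigma ^+ 2) (y i w)) - phi a b x) ^+ 2
     <= r ^+ 2).
  rewrite frobenius_le//; congr (_ <= _).
  apply: eq_bigr => a _; apply: eq_bigr => b _; congr (_ ^+ 2).
  by rewrite mxE [in X in _ + X]mxE covariance_empiricalE// covariance_tensorE.
have EE : E = ~` B.
  apply/seteqP; split=> [w Ew [x]|w nB].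
    apply/negP; rewrite -leNgt -frobE -lee_fin; apply: le_trans Ew.
    by apply: ereal_sup_ubound; exists x.
  apply: ge_ereal_sup => _ [x _ <-]; rewrite lee_fin frobE leNgt.
  by apply/negP => h; apply: nB; exists x.
have mE : measurable E by rewrite EE; exact: measurableC.
split=> //.
(* For [n = 1] the claim is trivial, because [1 <= D] makes the lower bound nonpositive. *)
have [n2|] := leqP 2 n; last first.
  rewrite ltnS => n1'; have -> : n = 1%N by apply/eqP; rewrite eqn_leq n1 n1'.
  rewrite powR1 mulr1; apply: (@le_trans _ _ 0%E) => //.
  by rewrite lee_fin subr_le0.
have n0' : 0 < n%:R :> R by rewrite ltr0n.
have l2 := ln_nat_ge_half R n2.
have u0 : 0 < ln n%:R / n%:R :> R by rewrite divr_gt0//; lra.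
pose tau := Num.sqrt kappa * Num.sqrt (ln n%:R / n%:R).
have tau0 : 0 < tau by rewrite mulr_gt0 ?sqrtr_gt0//; lra.
have ntau : n%:R * tau ^+ 2 = kappa * ln n%:R.
  rewrite exprMn !sqr_sqrtr; [|exact: ltW|by lra].
  by field; rewrite gt_eqF.
have ntau1 : 1 <= n%:R * tau ^+ 2 by rewrite ntau; nra.
pose bad (ab : 'I_d * 'I_d) := [set w : T | exists k, n%:R * (36 * L ^+ 2 * tau) <
  `|\sum_(i < n) ball_moment ab.1 ab.2
       (map_mx ratr (odflt (0, 0) (unpickle k) : 'rV[rat]_d * rat).1)
       (Num.min (ratr (odflt (0, 0) (unpickle k) : 'rV[rat]_d * rat).2) (L ^+ 2)) (y i w) -
     n%:R * \int[alpha]_z ball_moment ab.1 ab.2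
       (map_mx ratr (odflt (0, 0) (unpickle k) : 'rV[rat]_d * rat).1)
       (Num.min (ratr (odflt (0, 0) (unpickle k) : 'rV[rat]_d * rat).2) (L ^+ 2)) z|].
have mbad ab : measurable (bad ab) by exact: measurable_dev.
(* If every entry passes all rational tests, density extends the bound to every ball of radius
   [sigma]. *)
have Bbad : B `<=` \big[setU/set0]_(ab : 'I_d * 'I_d) bad ab.
  move=> w [x rx]; apply: contrapT => nbad.
  have dev_le a b x' : `|n%:R^-1 * (\sum_(k < n) ball_moment a b x' (sigma ^+ 2) (y k w)) -
      \int[alpha]_z ball_moment a b x' (sigma ^+ 2) z| <= 36 * L ^+ 2 * tau.
    apply: (@ball_deviation_dense R d alpha n (fun i => y i w)) => //.
    apply: ball_deviation_of_dev => // k; rewrite leNgt; apply/negP => hk.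
    by apply: nbad; rewrite -bigcup_seq; exists (a, b); [exact: mem_index_enum|exists k].
  move: rx; apply/negP; rewrite -leNgt.
  pose t := 36 * L ^+ 2 * tau.
  have t0 : 0 <= t by apply: mulr_ge0; [rewrite mulr_ge0 ?sqr_ge0|exact: ltW].
  have ct0 : 0 <= `|c| * t by exact: mulr_ge0.
  have dct0 : 0 <= d%:R * (`|c| * t) by rewrite mulr_ge0 ?(ltW d0).
  (* Bounding all [d ^ 2] entries by the same number yields the factor [d] in [C1]. *)
  apply: (@le_trans _ _ (\sum_(a < d) \sum_(b < d) (`|c| * t) ^+ 2)).
    apply: ler_sum => a _; apply: ler_sum => b _.
    rewrite /phi -mulrBr -[leLHS]real_normK ?num_real// ler_pXn2r ?nnegrE//.
    by rewrite normrM ler_wpM2l.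
 under eq_bigr do rewrite sumr_const card_ord.
  rewrite sumr_const card_ord -mulrnA -[leLHS]mulr_natl natrM -expr2 -exprMn.
  rewrite ler_pXn2r ?nnegrE//.
  have rl := rate_lower_bound R d2 n2.
  apply: (@le_trans _ _ (C1 * rate R d n)); last first.
    by rewrite ler_wpM2r ?rate_ge0// lerDl.
  have -> : C1 * rate R d n =
      d%:R * (`|c| * (36 * L ^+ 2 * (Num.sqrt kappa * (2 * rate R d n)))).
    by rewrite /C1; ring.
  apply: ler_wpM2l; first exact: ltW.
  apply: ler_wpM2l => //; apply: ler_wpM2l; first by rewrite mulr_ge0 ?sqr_ge0.
  by apply: ler_wpM2l; first exact: sqrtr_ge0.
have PB : (P B <= (D * n%:R `^ (- p))%:E)%E.
  apply: (@le_trans _ _ (P (\big[setU/set0]_(ab : 'I_d * 'I_d) bad ab))).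
    by apply: le_measure; rewrite ?inE//; exact: bigsetU_measurable.
  apply: (le_trans (measure_bigsetU_le P _ mbad)).
  apply: (@le_trans _ _ (\sum_(ab : 'I_d * 'I_d) (2 * (8 * 3 ^+ d.+2 * n%:R `^ (- p)))%:E)%E).
    apply: lee_sum => -[a b] _.
    apply: (le_trans (ball_deviation_probability iidy n1 L0 tau0 ntau1 a b)).
    rewrite lee_fin ler_pM2l// ntau; apply: le_trans (tail_bound d p n2).
    by rewrite /kappa (_ : 8 * _ * _ / 8 = (p + d.+2%:R) * ln n%:R)//; field.
  rewrite sumEFin sumr_const card_prod card_ord lee_fin -[leLHS]mulr_natl natrM /D.
  by rewrite le_eqVlt; apply/orP; left; apply/eqP; ring.
rewrite EE probability_setC// -(fineK (fin_num_measure P _ mB)) -EFinB lee_fin.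
by rewrite lerD2l lerN2 -lee_fin fineK ?fin_num_measure.
Qed.
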